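(* Let $\lambda_b>0$, $r_c>0$, $\alpha_c>2$, $P_t,C_c,\sigma^2>0$, $a_c,a_t>0$ with $a_c+a_t=1$, and $\gamma_c^{th}>0$ with $a_c-\gamma_c^{th}a_t>0$. Let $\Phi$ be a homogeneous Poisson point process of intensity $\lambda_b$ on $\{x\in\mathbb{R}^2:\|x\|>r_c\}$ with independent marks $H_x\sim$ Exp(1), and $I_c=\sum_{x\in\Phi}P_tC_c\|x\|^{-\alpha_c}H_x$. Let $G\sim$ Exp(1) be independent of $(\Phi,(H_x))$, and define $\gamma_c=\frac{a_cP_tC_cr_c^{-\alpha_c}G}{a_tP_tC_cr_c^{-\alpha_c}G+I_c+\sigma^2}$. Then $$\Pr\{\gamma_c>\gamma_c^{th}\}=\exp\left(-\Xi_3r_c^{\alpha_c}\right)\exp\left(-\Xi_4r_c^2\right),$$ where $\Xi_3=\frac{\gamma_c^{th}\sigma^2}{(a_c-\gamma_c^{th}a_t)P_tC_c}$ and $\Xi_4=\pi\lambda_b\left({}_2F_1\left(-\tfrac2{\alpha_c},1;1-\tfrac2{\alpha_c};-\frac{\gamma_c^{th}}{a_c-\gamma_c^{th}a_t}\right)-1\right)$, with ${}_2F_1$ the Gauss hypergeometric function.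
   Context: Interpretation: coverage probability of the connected (non-RIS-aided) NOMA user at fixed distance $r_c$ from its base station, decoding its own message while treating the partner's signal as interference; $G$ is its Rayleigh power fading, and interfering base stations lie outside radius $r_c$. (The paper writes $\Xi_3,\Xi_4$ with a factor $\eta_c=1$, which has been substituted.) *)

(* Defs.v *)
From HB Require Import structures.
From mathcomp Require Import all_boot all_order all_algebra.
From mathcomp Require Import all_classical all_reals all_analysis.
Set Implicit Arguments. Unset Strict Implicit. Unset Printing Implicit Defensive.
Import Order.TTheory GRing.Theory Num.Def Num.Theory.
Import numFieldNormedType.Exports.
Local Open Scope classical_set_scope.
Local Open Scope ring_scope.

Definition norm2 {R : realType} (x : R * R) : R := Num.sqrt (x.1 ^+ 2 + x.2 ^+ 2).

Definition poch {R : realType} (a : R) (n : nat) : R := \prod_(i < n) (a + i%:R).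

Definition gauss_term {R : realType} (a b c z : R) (n : nat) : R :=
  poch a n * poch b n / (poch c n * n`!%:R) * z ^+ n.

(* Gauss hypergeometric function 2F1(a,b;c;z) for real z < 1:
   the Gauss series on |z| < 1, and its (principal-branch) analytic
   continuation via the Pfaff transformation
   2F1(a,b;c;z) = (1-z)^(-b) 2F1(c-a,b;c;z/(z-1)) for z <= -1.
   (Values for z >= 1 are not meaningful.) *)
Definition hyp2F1 {R : realType} (a b c z : R) : R :=
  if `|z| < 1 then limn (series (gauss_term a b c z))
  else powR (1 - z) (- b) * limn (series (gauss_term (c - a) b c (z / (z - 1)))).

Definition poisson_pk {R : realType} (m : R) (k : nat) : R :=
  expR (- m) * m ^+ k / k`!%:R.

(* Intensity measure of the independently Exp(1)-marked homogeneous PPP of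
   intensity lam on {x in R^2 | ||x|| > rc}:
   Lambda(A) = lam * int_{R^2} int_{[0,oo)} 1_A(x,h) 1{||x||>rc} e^{-h} dh dx. *)
Definition mppp_intensity {R : realType} (lam rc : R) (A : set ((R * R) * R))
  : \bar R :=
  (lam%:E * \int[lebesgue_measure]_(x1 in [set: R])
              \int[lebesgue_measure]_(x2 in [set: R])
                \int[lebesgue_measure]_(h in [set h : R | (0 <= h)%R])
                   (\1_A ((x1, x2), h) * \1_[set y | rc < norm2 y] (x1, x2)
                      * expR (- h))%:E)%E.

Definition mcount {d} {T : measurableType d} {R : realType}
  (X : nat -> T -> R * R) (H : nat -> T -> R) (A : set ((R * R) * R)) (w : T)
  : \bar R :=
  (\sum_(n <oo) (\1_A (X n w, H n w))%:E)%E.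

(* The points X n (n : nat) with marks H n form an independently Exp(1)-marked
   homogeneous Poisson point process of intensity lam on {||x|| > rc}
   (i.e. a Poisson process on R^2 x R with intensity measure mppp_intensity),
   and G is Exp(1)-distributed and independent of the marked process.
   Jointly: for pairwise disjoint measurable A_i of finite intensity and any
   Borel B, P(G in B, N(A_i) = n_i for all i) = P(G in B) prod_i Poi(n_i). *)
Definition marked_ppp_indep {d} {T : measurableType d} {R : realType}
  (P : probability T R) (lam rc : R)
  (X : nat -> T -> R * R) (H : nat -> T -> R) (G : T -> R) : Prop :=
  [/\ (forall n, measurable_fun [set: T] (X n)),
      (forall n, measurable_fun [set: T] (H n)),
      measurable_fun [set: T] G,
      (forall B : set R, measurable B ->
         P (G @^-1` B) = exponential_prob (1 : R) B) &
      (forall (k : nat) (A : 'I_k -> set ((R * R) * R)) (ns : 'I_k -> nat)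
              (B : set R),
         (forall i, measurable (A i)) ->
         (forall i, (mppp_intensity lam rc (A i) < +oo)%E) ->
         (forall i j, i != j -> A i `&` A j = set0) ->
         measurable B ->
         P (G @^-1` B `&` \bigcap_(i in [set: 'I_k])
              [set w | mcount X H (A i) w = ((ns i)%:R)%:E])
         = (P (G @^-1` B) *
            \prod_(i < k) (poisson_pk (fine (mppp_intensity lam rc (A i))) (ns i))%:E)%E)].

Definition interference {d} {T : measurableType d} {R : realType}
  (Pt Cc alpha : R) (X : nat -> T -> R * R) (H : nat -> T -> R) (w : T)
  : \bar R :=
  (\sum_(n <oo) (Pt * Cc * powR (norm2 (X n w)) (- alpha) * H n w)%:E)%E.

(* Main.v *)
(* On the almost sure event where [G >= 0] and all points lie outside the disc with
   nonnegative marks, the coverage event reads [K * Ic + t < G] with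
   [t = K * s2 = Xi3 * rc ^ alpha].  As [G] is exponential and independent of the
   process, its probability is [exp (- t)] times the Laplace transform of [Ic] at [K].
   This is computed without conditioning: for a step function with finitely many
   levels the hypothesis gives the joint law of [G] and the counts, and summing over the
   values of the counts gives [exp (- int (1 - exp (- f)) dLambda)]; monotone
   approximation does the rest.  Integrating out the exponential mark turns the exponent
   into the integral of [s / (1 + s)], [s = z0 * (|x| / rc) ^ (- alpha)], over
   [|x| > rc], whose radial antiderivative is a multiple of [r * (2F1 - 1)] by the
   first-order differential equation satisfied by [2F1 (- d, 1; 1 - d; - s)]. *)
Require Import Defs.
From HB Require Import structures.
From mathcomp Require Import all_boot all_order all_algebra.
From mathcomp Require Import all_classical all_reals all_analysis.
From mathcomp Require Import measurable_realfun ring lra.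
Set Implicit Arguments. Unset Strict Implicit. Unset Printing Implicit Defensive.
Import Order.TTheory GRing.Theory Num.Def Num.Theory.
Import numFieldNormedType.Exports.
Local Open Scope classical_set_scope.
Local Open Scope ring_scope.

(** * Power series and the hypergeometric function *)

(** The hypothesis fixes the law of counts only on sets of finite intensity, while the exterior of
    the disc has infinite intensity. The step functions are therefore decomposed over their nonzero
    levels only, and these have finite intensity because the limiting exponent is finite. The
    approximation is run on the event with [<=]: it is the decreasing intersection of the events of
    the approximants, and the strict event follows by continuity in [t]. Conditioning on the process
    is avoided thanks to the exponential tail: raising the threshold of [G] by [c * n] multiplies
    the tail by [expR (- c) ^+ n], whose Poisson average is a generating function.

    The argument [z0 = th / (ac - th * at_)] can be any positive number, so both branches of
    [hyp2F1] occur. They are never shown to agree: [z0] selects one branch, which is then used on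
    the whole interval [[0, z0]], the Pfaff form being available for every [s >= 0]. *)

Section power_series.
Context {R : realType}.
Implicit Types (a b : R^nat) (x y : R).

(** Radius of convergence at least 1, encoded by boundedness rather than by a limit superior: in
    this form it passes easily to shifts, to multiplication by [n], and so to derivatives. *)
Definition subexponential a :=
  forall y, 0 < y < 1 -> exists M, forall n, `|a n| * y ^+ n <= M.

Definition psum a x := limn (pseries a x).

(** The geometric sum [1 + p + ... + p ^+ n] has [n + 1] terms, each at least [p ^+ n]; the
    induction proves this with the sum in closed form. *)
Lemma natS_mul_expr_le (p : R) n : 0 <= p < 1 ->
  n.+1%:R * p ^+ n <= (1 - p)^-1.
Proof.
move=> /andP[p0 p1]; have q0 : 0 < 1 - p by rewrite subr_gt0.
rewrite -[leRHS]mul1r ler_pdivlMr//.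
have : n.+1%:R * p ^+ n * (1 - p) <= 1 - p ^+ n.+1.
  elim: n => [|n ih]; first by rewrite expr0 expr1 !mul1r.
  have h0 : 0 <= p ^+ n by exact: exprn_ge0.
  have h1 : p ^+ n.+1 <= 1 by exact: exprn_ile1 (ltW p1).
  have := ler_wpM2l p0 ih; rewrite -[n.+2%:R]natr1 !exprS in h1 *.
  by move: (n.+1%:R) (p ^+ n) h0 h1 => A B *; nra.
move/le_trans; apply; rewrite gerBl; exact: exprn_ge0.
Qed.

Lemma subexponential_cvg a x : subexponential a -> `|x| < 1 -> cvgn (pseries a x).
Proof.
move=> sa x1; pose y := (`|x| + 1) / 2.
have x0 := normr_ge0 x.
have y0 : 0 < y by rewrite /y; lra.
have [M Ma] : exists M, forall n, `|a n| * y ^+ n <= M.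
  by apply: sa; rewrite y0 /y; lra.
have M0 : 0 <= M by apply: le_trans (Ma 0%N); rewrite expr0 mulr1.
have q0 : 0 <= `|x| / y by rewrite divr_ge0// ltW.
apply: normed_cvg.
apply: (@series_le_cvg _ _ (geometric M (`|x| / y))) => [n|n|n|] //=.
- by rewrite mulr_ge0// exprn_ge0.
- have e : `|x| ^+ n = (`|x| / y) ^+ n * y ^+ n by rewrite -exprMn divfK ?gt_eqF.
  by rewrite normrM normrX e mulrCA [leRHS]mulrC ler_wpM2l// exprn_ge0.
- by apply: is_cvg_geometric_series; rewrite ger0_norm// ltr_pdivrMr// mul1r /y; lra.
Qed.

Lemma subexponential_natSmul a : subexponential a ->
  subexponential (fun n => n.+1%:R * a n).
Proof.
move=> sa y /andP[y0 y1]; pose z := (y + 1) / 2.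
have z0 : 0 < z by rewrite /z; lra.
have yz : y < z by rewrite /z; lra.
have [M Ma] : exists M, forall n, `|a n| * z ^+ n <= M.
  by apply: sa; rewrite z0 /z; lra.
have q : 0 <= y / z < 1.
  by rewrite divr_ge0 ?(ltW y0) ?(ltW z0)//= ltr_pdivrMr ?mul1r.
exists (M * (1 - y / z)^-1) => n.
rewrite normrM (ger0_norm (ler0n _ _)).
have -> : n.+1%:R * `|a n| * y ^+ n = `|a n| * z ^+ n * (n.+1%:R * (y / z) ^+ n).
  rewrite -{1}(divfK (lt0r_neq0 z0) y) exprMn; ring.
have qn : 0 <= y / z by case/andP: q.
apply: ler_pM; last exact: natS_mul_expr_le.
- by rewrite !mulr_ge0 ?invr_ge0 ?exprn_ge0// ltW.
- by rewrite mulr_ge0// exprn_ge0.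
- exact: Ma.
Qed.

Lemma subexponential_shift a : subexponential a -> subexponential (fun n => a n.+1).
Proof.
move=> sa y y01; have [M Ma] := sa _ y01; exists (M / y) => n.
have y0 : 0 < y by case/andP: y01.
by rewrite ler_pdivlMr// -mulrA -exprSr.
Qed.

Lemma subexponential_diffs a : subexponential a -> subexponential (pseries_diffs a).
Proof. by move=> /subexponential_shift/subexponential_natSmul. Qed.

Lemma subexponential_natmul a : subexponential a ->
  subexponential (fun n => n%:R * a n).
Proof.
move=> /subexponential_natSmul sa y y01; have [M Ma] := sa _ y01.
have y0 : 0 <= y by case/andP: y01 => /ltW.
exists M => n; apply: le_trans (Ma n); rewrite ler_wpM2r ?exprn_ge0//.
by rewrite !normrM ler_wpM2r// !normr_nat ler_nat.
Qed.

Lemma linear_subexponential a C :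
  (forall n, `|a n| <= C * n.+1%:R) -> subexponential a.
Proof.
move=> aC y /andP[y0 y1]; exists (C * (1 - y)^-1) => n.
have C0 : 0 <= C by have := le_trans (normr_ge0 _) (aC 0%N); rewrite mulr1.
apply: (@le_trans _ _ (C * (n.+1%:R * y ^+ n))).
  by rewrite mulrA ler_wpM2r// exprn_ge0// ltW.
by rewrite ler_wpM2l// natS_mul_expr_le// ltW.
Qed.

Lemma is_derive_psum a x : subexponential a -> `|x| < 1 ->
  is_derive x (1 : R) (psum a) (psum (pseries_diffs a) x).
Proof.
(* Termwise differentiation needs the series and its first two derived series to converge at a point
   beyond [x]; the midpoint between the modulus of [x] and 1 serves. *)
move=> sa x1; pose y := (`|x| + 1) / 2.
have x0 := normr_ge0 x.
have y1 : `|y| < 1 by rewrite ger0_norm /y; lra.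
apply: (@pseries_snd_diffs R a y x).
- exact: subexponential_cvg.
- by apply: subexponential_cvg => //; exact: subexponential_diffs.
- by apply: subexponential_cvg => //; do 2 apply: subexponential_diffs.
- rewrite [ltRHS]ger0_norm /y; lra.
Qed.

Lemma psum_lin a b (k l : R) x : cvgn (pseries a x) -> cvgn (pseries b x) ->
  psum (fun n => k * a n + l * b n) x = k * psum a x + l * psum b x.
Proof.
move=> ca cb; apply/cvg_lim => //.
have -> : pseries (fun n => k * a n + l * b n) x =
    (fun n => k * pseries a x n + l * pseries b x n).
  apply/funext => n; rewrite /pseries /series/= !mulr_sumr -big_split/=.
  by apply: eq_bigr => i _; rewrite mulrDl !mulrA.
by apply: cvgD; apply: cvgMl_tmp.
Qed.

Lemma psum_shift a x : cvgn (pseries (fun n => a n.+1) x) ->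
  psum a x = a 0%N + x * psum (fun n => a n.+1) x.
Proof.
move=> ca; apply/cvg_lim => //.
rewrite -cvg_shiftS /=.
have -> : (fun n => pseries a x n.+1) =
    (fun n => a 0%N + x * pseries (fun n => a n.+1) x n).
  apply/funext => n; rewrite /pseries /series/= big_nat_recl//= expr0 mulr1.
  rewrite mulr_sumr; congr (_ + _); apply: eq_bigr => i _.
  by rewrite exprS mulrCA.
by apply: cvgD; [exact: cvg_cst|exact: cvgMl_tmp].
Qed.

Lemma psum_natmul a x : cvgn (pseries (pseries_diffs a) x) ->
  psum (fun n => n%:R * a n) x = x * psum (pseries_diffs a) x.
Proof. by move=> ca; rewrite psum_shift// mul0r add0r. Qed.

Lemma psum0 a : psum a 0 = a 0%N.
Proof.
apply/cvg_lim => //; rewrite -cvg_shiftS /=.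
have -> : (fun n => pseries a 0 n.+1) = (fun=> a 0%N).
  apply/funext => n; rewrite /pseries /series/= big_nat_recl//= expr0 mulr1.
  by rewrite big1 ?addr0// => i _; rewrite expr0n mulr0.
exact: cvg_cst.
Qed.

End power_series.

Section hypergeometric.
Context {R : realType}.

Lemma poch_S (a : R) n : poch a n.+1 = poch a n * (a + n%:R).
Proof. by rewrite /poch big_ord_recr. Qed.

Lemma poch_Sl (a : R) n : poch a n.+1 = a * poch (a + 1) n.
Proof.
rewrite /poch big_ord_recl/= addr0; congr (_ * _); apply: eq_bigr => i _.
by rewrite -addrA /bump/= add1n -natr1; congr (_ + _); rewrite addrC.
Qed.

Lemma poch1 n : poch (1 : R) n = n`!%:R.
Proof.
elim: n => [|n ih]; first by rewrite /poch big_ord0.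
by rewrite poch_S ih factS natrM mulrC nat1r.
Qed.

Lemma poch_gt0 (a : R) n : 0 < a -> 0 < poch a n.
Proof. by move=> a0; apply: prodr_gt0 => i _; rewrite ltr_wpDr. Qed.

Definition gauss_coef (a b c : R) n := poch a n * poch b n / (poch c n * n`!%:R).

Lemma limn_gauss_term (a b c z : R) :
  limn (series (gauss_term a b c z)) = psum (gauss_coef a b c) z.
Proof. by []. Qed.

Variable d : R.
Hypothesis d01 : 0 < d < 1.
Let d0 : 0 < d. Proof. by case/andP: d01. Qed.
Let c0 : 0 < 1 - d. Proof. by case/andP: d01 => _; rewrite subr_gt0. Qed.

(** [A] belongs to the Gauss series itself, [B] to its Pfaff transform, where
    [c - a = (1 - d) + d = 1]. *)
Let A := gauss_coef (- d) 1 (1 - d).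
Let B := gauss_coef 1 1 (1 - d).

Let A0 : A 0%N = 1.
Proof. by rewrite /A /gauss_coef /poch !big_ord0 fact0 !mulr1 divr1. Qed.
Let B0 : B 0%N = 1.
Proof. by rewrite /B /gauss_coef /poch !big_ord0 fact0 !mulr1 divr1. Qed.

(** The Pochhammer products telescope, so the operator [x d/dx - d] sends the series of [A] to a
    geometric series. *)
Let AE n : (n%:R - d) * A n = - d.
Proof.
rewrite /A /gauss_coef poch1 mulrC.
have := poch_Sl (- d) n; rewrite poch_S (addrC (- d) n%:R) (addrC (- d) 1).
have := poch_gt0 n c0; have : n`!%:R != 0 :> R by rewrite pnatr_eq0 -lt0n fact_gt0.
move: (poch (- d) n) (poch (1 - d) n) (n`!%:R) => p q f f0 q0 E.
have -> : p * f / (q * f) * (n%:R - d) = p * (n%:R - d) / q.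
  by field; rewrite f0 gt_eqF.
by rewrite E mulfK// gt_eqF.
Qed.

Let BE n : (1 - d + n%:R) * B n.+1 = n.+1%:R * B n.
Proof.
rewrite /B /gauss_coef !poch1 poch_S factS natrM.
have := poch_gt0 n c0; have : n`!%:R != 0 :> R by rewrite pnatr_eq0 -lt0n fact_gt0.
have : 0 < 1 - d + n%:R by rewrite ltr_wpDr.
have : n.+1%:R != 0 :> R by rewrite pnatr_eq0.
move: (poch (1 - d) n) (n`!%:R) (n.+1%:R) => q f m m0 e0 f0 q0.
by field; rewrite f0 m0 !gt_eqF.
Qed.

Let B_gt0 n : 0 < B n.
Proof.
by rewrite /B /gauss_coef divr_gt0// mulr_gt0 ?poch_gt0// ltr0n fact_gt0.
Qed.

Let A_subexp : subexponential A.
Proof.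
apply: (@linear_subexponential _ _ (1 + d / (1 - d))) => -[|n].
  by rewrite A0 normr1 mulr1 lerDl divr_ge0// ltW.
apply: (@le_trans _ _ (d / (1 - d))); last first.
  have q0 : 0 <= d / (1 - d) by rewrite divr_ge0// ltW.
  have m1 : 1 <= n.+2%:R :> R by rewrite ler1n.
  by rewrite (le_trans (_ : _ <= 1 + d / (1 - d)))// ?ler_peMr// ?lerDr// addr_ge0.
have d1 : d < 1 by case/andP: d01.
have h : 0 < n.+1%:R - d by rewrite subr_gt0 (lt_le_trans d1)// ler1n.
have -> : A n.+1 = - d / (n.+1%:R - d).
  by rewrite -[X in X / _](AE n.+1) mulrAC divff ?mul1r// gt_eqF.
have q0 : 0 <= d / (n.+1%:R - d) by rewrite divr_ge0// ltW.
rewrite mulNr normrN (ger0_norm q0) ler_pM2l// lef_pV2//.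
by rewrite lerD2r ler1n.
Qed.

(** The ratio of consecutive coefficients is [(n + 1) / (n + 1 - d)], so [B n] grows like the power
    [d < 1] of [n]; the cruder linear bound goes through by induction. *)
Let B_subexp : subexponential B.
Proof.
apply: (@linear_subexponential _ _ (1 - d)^-1) => n.
rewrite ger0_norm; last exact: ltW.
case: n => [|n]; first by rewrite B0 mulr1 invf_ge1// gerBl ltW.
have : (1 - d) * B n.+1 <= n.+1%:R.
  elim: n => [|n ih]; first by have := BE 0%N; rewrite addr0 B0 mulr1 => ->.
  have h : 0 <= (1 - d) * B n.+2 by rewrite mulr_ge0// ltW.
  have e := BE n.+1.
  have h2 : 0 < n.+1%:R :> R by rewrite ltr0n.
  have c1 := c0; have h3 : 0 < 1 - d + n.+1%:R by rewrite ltr_wpDr.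
  rewrite -(ler_pM2l h3) mulrCA e -[n.+2%:R]natr1 mulrCA.
  move: (n.+1%:R) (B n.+1) ih h2 => m b; nra.
move=> h; rewrite [leRHS]mulrC ler_pdivlMr// mulrC; apply: le_trans h _.
by rewrite ler_nat.
Qed.

Let psum_euler a x : subexponential a -> `|x| < 1 ->
  psum (fun n => (n%:R - d) * a n) x = x * psum (pseries_diffs a) x - d * psum a x.
Proof.
move=> sa x1.
have ca := subexponential_cvg sa x1.
have cd := subexponential_cvg (subexponential_diffs sa) x1.
rewrite -psum_natmul// -mulNr -[X in X + _]mul1r.
rewrite -psum_lin//; last exact/subexponential_cvg/x1/subexponential_natmul.
by congr psum; apply/funext => n; rewrite mul1r mulrDl.
Qed.

Let Phi1 s := psum A (- s) - 1.
Let Phi2 s := (1 + s)^-1 * psum B (s / (1 + s)) - 1.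

(* Both branches of [hyp2F1] satisfy the first-order equation
   [s Phi' = d Phi + d s / (1 + s)] for [Phi s = 2F1(-d, 1; 1 - d; -s) - 1]; it says
   that [r * Phi (s r)] has derivative [- s r / (1 + s r)] when [s r] is
   proportional to [r ^ (- 1 / d)]. *)
Lemma hyp2F1_ode (z0 : R) : 0 < z0 -> exists Phi dPhi : R -> R,
  [/\ Phi 0 = 0, Phi z0 = hyp2F1 (- d) 1 (1 - d) (- z0) - 1 &
      forall s, 0 <= s <= z0 -> is_derive s (1 : R) Phi (dPhi s) /\
        s * dPhi s = d * Phi s + d * (s / (1 + s))].
Proof.
move=> z0_gt0; rewrite /hyp2F1 normrN gtr0_norm//; case: ltP => z01.
  (* Here [s <= z0 < 1], so the Gauss series converges on the whole interval. *)
  exists Phi1, (fun s => - psum (pseries_diffs A) (- s)); split.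
  - by rewrite /Phi1 oppr0 psum0 A0 subrr.
  - by rewrite limn_gauss_term.
  move=> s /andP[s0 sz]; have s1 : `|- s| < 1 by by rewrite normrN ger0_norm//; lra.
  split.
    rewrite /Phi1; have dA := is_derive_psum A_subexp s1.
    have dN : is_derive s (1:R) (fun s => - s) (- 1) by apply: is_deriveN.
    have dc : is_derive s (1:R) (fun s => psum A (- s))
        (psum (pseries_diffs A) (- s) * - 1) by exact: is_derive1_comp.
    by apply: is_derive_eq; rewrite oppr0 addr0 mulrN1.
  have := psum_euler A_subexp s1.
  have -> : psum (fun n => (n%:R - d) * A n) (- s) = - d * (1 + s)^-1.
    rewrite (_ : (fun n => _) = fun=> - d); last by apply/funext => n; exact: AE.
    apply/cvg_lim => //.
    rewrite (_ : pseries _ _ = series (geometric (- d) (- s)))//.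
    by have := @cvg_geometric_series _ (- d) _ s1; rewrite opprK.
  have s1p : 1 + s != 0 by rewrite gt_eqF//; lra.
  rewrite /Phi1; set F' := psum (pseries_diffs A) _; set F := psum A _ => E.
  have -> : s * - F' = - s * F' by rewrite mulrN mulNr.
  have -> : - s * F' = d * F - d * (1 + s)^-1.
    by rewrite -mulNr E addrC subrK.
  by field.
(* For [z0 >= 1] the Pfaff form is used for small [s] as well: [s / (1 + s) < 1] for all
   [s >= 0]. *)
exists Phi2, (fun s => (1 + s)^-1 ^+ 3 * psum (pseries_diffs B) (s / (1 + s))
    - (1 + s)^-1 ^+ 2 * psum B (s / (1 + s))); split.
- by rewrite /Phi2 mul0r psum0 B0 addr0 invr1 mulr1 subrr.
- rewrite !opprK subrK limn_gauss_term powRN powRr1; last lra.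
  by rewrite -opprD invrN mulrNN [z0 + 1]addrC.
move=> s /andP[s0 sz].
have s1p : 0 < 1 + s by lra.
have s1 : `|s / (1 + s)| < 1.
  have h : 0 <= s / (1 + s) by rewrite divr_ge0// ltW.
  by rewrite ger0_norm// ltr_pdivrMr// mul1r ltrDr.
have cB := subexponential_cvg B_subexp s1.
have cdB := subexponential_cvg (subexponential_diffs B_subexp) s1.
split.
  rewrite /Phi2; have dB := is_derive_psum B_subexp s1.
  have d1 : is_derive s (1:R) (fun s => 1 + s) 1.
    by apply: is_derive_eq; rewrite add0r mulr1.
  have s1p' : 1 + s != 0 by rewrite gt_eqF.
  have d2 : is_derive s (1:R) (fun s => (1 + s)^-1) (- (1 + s) ^- 2).
    by apply: is_derive_eq; rewrite /GRing.scale/= mulr1.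
  have d3 : is_derive s (1:R) (fun s => s / (1 + s)) ((1 + s) ^- 2).
    apply: is_derive_eq; rewrite /GRing.scale/=; by field.
  have d4 : is_derive s (1:R) (fun s => psum B (s / (1 + s)))
      (psum (pseries_diffs B) (s / (1 + s)) * (1 + s) ^- 2).
    exact: is_derive1_comp.
  apply: is_derive_eq; rewrite /GRing.scale/=; by field.
have := psum_euler B_subexp s1.
(* After the shift the recurrence for [B] reads [(n + 1 - d) * B (n + 1) = n * B n + B n], which
   turns the Euler identity into a first-order equation in [y = s / (1 + s)]. *)
rewrite psum_shift; last first.
  rewrite (_ : (fun n => _) = fun n => n.+1%:R * B n); last first.
    by apply/funext => n; rewrite -BE -natr1; congr (_ * _); ring.
  exact/subexponential_cvg/s1/subexponential_natSmul.
rewrite (_ : (fun n => _) = fun n => 1 * (n%:R * B n) + 1 * B n); last first.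
  apply/funext => n; rewrite !mul1r -[X in _ = _ + X]mul1r -mulrDl natr1 -BE -natr1.
  by congr (_ * _); ring.
rewrite psum_lin//; last exact/subexponential_cvg/s1/subexponential_natmul.
rewrite psum_natmul// B0 /Phi2 => E.
apply/eqP; rewrite -subr_eq0; apply/eqP.
move: E; set h := psum B _; set h' := psum _ _; set y := s / (1 + s) => E.
(* The defect of the required equation is the defect of [E] divided by [1 + s]. *)
transitivity ((y * h' - d * h - ((0 - d) * 1 + y * (1 * (y * h') + 1 * h))) / (1 + s)).
  by rewrite /y; field; rewrite gt_eqF.
by rewrite E subrr mul0r.
Qed.

End hypergeometric.

(** * Radial integrals over the plane *)

Section lebesgue_integral_line.
Context {R : realType}.
Local Open Scope ereal_scope.
Notation mu := (@lebesgue_measure R).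

(** By uniqueness of Lebesgue measure it is enough to compare both sides on half-open intervals. *)
Lemma lebesgue_measure_scale (c : R) (A : set R) : (0 < c)%R -> measurable A ->
  mu A = c%:E * mu ( *%R c @^-1` A).
Proof.
move=> c0 mA.
have c0' : (0 <= c)%R by exact: ltW.
have mphi : measurable_fun [set: measurableTypeR R]
    ( *%R c : measurableTypeR R -> measurableTypeR R) by exact: measurable_funM.
pose phi : {mfun measurableTypeR R >-> measurableTypeR R} :=
  HB.pack ( *%R c) (isMeasurableFun.Build _ _ _ _ _ mphi).
rewrite (@lebesgue_measure_unique R (mscale (NngNum c0') (pushforward mu phi)))//.
move=> _ [[a b]] _ <-/=.
rewrite /mscale/= /pushforward.
have -> : phi @^-1` `]a, b]%classic = `](a / c)%R, (b / c)%R]%classic.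
  by apply/seteqP; split => x/=; rewrite !in_itv/= ltr_pdivrMr// ler_pdivlMr// mulrC.
rewrite !lebesgue_measure_itv/= !lte_fin ltr_pM2r ?invr_gt0//.
case: ifP => _; last by rewrite mule0.
by rewrite -!EFinB -EFinM -mulrBl mulrCA divff ?gt_eqF// mulr1.
Qed.

Lemma ge0_integral_scale (c : R) (f : R -> \bar R) : (0 < c)%R ->
  measurable_fun [set: R] f -> (forall x, 0 <= f x) ->
  \int[mu]_x f x = c%:E * \int[mu]_x f (c * x)%R.
Proof.
move=> c0 mf f0; have c0' : (0 <= c)%R by exact: ltW.
have mphi : measurable_fun [set: measurableTypeR R]
    ( *%R c : measurableTypeR R -> measurableTypeR R) by exact: measurable_funM.
pose nu : {measure set (measurableTypeR R) -> \bar R} :=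
  pushforward mu ( *%R c : measurableTypeR R -> measurableTypeR R).
transitivity (\int[mscale (NngNum c0') (nu mphi)]_x f x).
  apply: eq_measure_integral => A mA _.
  exact: lebesgue_measure_scale.
rewrite ge0_integral_mscale//=.
by rewrite (ge0_integral_pushforward mphi)//= => x _; exact: f0.
Qed.

Lemma ge0_integral_even (f : R -> \bar R) :
  measurable_fun [set: R] f -> (forall x, 0 <= f x) ->
  (forall x, f (- x)%R = f x) ->
  \int[mu]_x f x = 2%:E * \int[mu]_(x in `]0%R, +oo[) f x.
Proof.
move=> mf f0 fN.
rewrite -(setUv `]-oo, 0%R]%classic) ge0_integral_setU//=; last 3 first.
  exact: measurableC.
  by rewrite setUv.
  exact/disj_setPCl.
rewrite setCitvl.
have -> : \int[mu]_(x in `]-oo, 0%R]) f x = \int[mu]_(x in `]0%R, +oo[) f x.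
  under eq_integral do rewrite -fN.
  rewrite -ge0_integration_by_substitution0//.
  by rewrite integral_itv_obnd_cbnd//; exact: measurable_funTS.
by rewrite mule_natl mule2n.
Qed.

Lemma measurable_oneDsqrV :
  measurable_fun [set: R] (fun x => ((oneDsqr x)^-1)%R%:E).
Proof.
apply/measurable_EFinP; apply: continuous_measurable_fun => x.
exact: continuous_oneDsqrV.
Qed.

Lemma integral_oneDsqrV : \int[mu]_x ((oneDsqr x)^-1)%R%:E = pi%:E.
Proof.
rewrite ge0_integral_even//.
- rewrite integral_itv_obnd_cbnd; last exact: measurable_funTS measurable_oneDsqrV.
  by rewrite (integral0y_oneDsqr R) -EFinM mulrCA divff// mulr1.
- exact: measurable_oneDsqrV.
- by move=> x; rewrite /oneDsqr sqrrN.
Qed.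

(* Polar coordinates in the guise of the substitution [x2 = x1 * t], where
   [1 + t ^+ 2] plays the role of [k] and the angle integrates to [pi]. *)
Lemma ge0_integral_plane_radial (v : R -> R) (I : R) :
  measurable_fun [set: R] v -> (forall x, 0 <= v x)%R ->
  (forall k, (0 < k)%R ->
    \int[mu]_(x in `]0%R, +oo[) (v (x ^+ 2 * k) * x)%:E = (I / (2 * k))%:E) ->
  \int[mu]_x1 \int[mu]_x2 (v (x1 ^+ 2 + x2 ^+ 2))%:E = (pi * I)%:E.
Proof.
move=> mv v0 vI.
have mv2 : measurable_fun [set: measurableTypeR R * measurableTypeR R]
    (fun z => (v (z.1 ^+ 2 + z.2 ^+ 2))%:E).
  apply/measurable_EFinP; apply: measurableT_comp => //.
  by apply: measurable_funD; apply: measurable_funX.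
rewrite ge0_integral_even; last 3 first.
- have h z : 0 <= (v (z.1 ^+ 2 + z.2 ^+ 2))%:E by rewrite lee_fin.
  exact: (@measurable_fun_fubini_tonelli_F _ _ _ _ R mu _ mv2 h).
- by move=> x; apply: integral_ge0 => y _; rewrite lee_fin.
- by move=> x; rewrite sqrrN.
(* The factor [maxr z.1 0] is at once the Jacobian of the substitution and the restriction to the
   right half-plane, so Tonelli applies on the whole plane. *)
pose w (z : R * R) := (v (z.1 ^+ 2 * oneDsqr z.2) * maxr z.1 0)%:E.
have w0 z : 0 <= w z by rewrite lee_fin mulr_ge0// le_max lexx orbT.
have mw : measurable_fun [set: measurableTypeR R * measurableTypeR R] w.
  apply/measurable_EFinP; apply: measurable_funM.
    apply: measurableT_comp => //; apply: measurable_funM.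
      exact: measurable_funX.
    apply: (@measurableT_comp _ _ _ _ _ _ (@oneDsqr R)) => //.
    by apply: continuous_measurable_fun => x; exact: continuous_oneDsqr.
  exact: measurable_maxr.
have -> : \int[mu]_(x in `]0%R, +oo[) \int[mu]_y (v (x ^+ 2 + y ^+ 2))%:E =
    \int[mu]_x \int[mu]_t w (x, t).
  rewrite integral_mkcond; apply: eq_integral => x _; rewrite patchE.
  case: ifPn => [|]; rewrite ?inE/= ?notin_setE/= in_itv/= andbT.
    move=> x0; rewrite (ge0_integral_scale x0); last 2 first.
    - exact: (measurableT_comp mv2 (measurable_pair1 x)).
    - by move=> y; rewrite lee_fin.
    rewrite -ge0_integralZl_EFin//; last 3 first.
    - by move=> y _; rewrite lee_fin.
    - have mx : measurable_fun [set: R] (fun y : R => x * y)%R.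
        exact: measurable_funM.
      exact: (measurableT_comp (measurableT_comp mv2 (measurable_pair1 x)) mx).
    - exact: ltW.
    apply: eq_integral => t _; rewrite /w/= -EFinM mulrC.
    by rewrite /oneDsqr mulrDr mulr1 exprMn (max_idPl (ltW x0)).
  move/negP; rewrite -leNgt => x0; rewrite integral0_eq// => t _.
  by rewrite /w/= (max_idPr x0) mulr0.
rewrite (fubini_tonelli _ mw)//.
have -> : \int[mu]_t \int[mu]_x w (x, t) =
    \int[mu]_t ((I / 2)%:E * ((oneDsqr t)^-1)%R%:E).
  apply: eq_integral => t _.
  rewrite -EFinM -mulrA -invfM -vI ?oneDsqr_gt0// [RHS]integral_mkcond.
  apply: eq_integral => x _; rewrite patchE /w/=.
  case: ifPn => [|]; rewrite ?inE/= ?notin_setE/= in_itv/= andbT.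
    by move=> x0; rewrite (max_idPl (ltW x0)).
  by move/negP; rewrite -leNgt => x0; rewrite (max_idPr x0) mulr0.
rewrite ge0_integralZl_EFin//.
- by rewrite integral_oneDsqrV -!EFinM; congr EFin; field.
- exact: measurable_oneDsqrV.
- have := vI 1%R ltr01; rewrite mulr1 => h; rewrite -lee_fin -h.
  apply: integral_ge0 => x /=; rewrite in_itv/= andbT => /ltW x0.
  by rewrite lee_fin mulr_ge0.
Qed.


End lebesgue_integral_line.

(** * Decay at infinity and one-dimensional radial integrals *)

Section radial_integral.
Context {R : realType}.
Notation mu := (@lebesgue_measure R).

Lemma cvgy_powRN (p : R) : 0 < p -> x `^ (- p) @[x --> +oo] --> 0.
Proof.
move=> p0; apply/cvgrPdist_lt => e e0.
have [M M0 ->] : exists2 M : R, 0 < M & e = M `^ (- p).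
  exists (e `^ (- p^-1)); first exact: powR_gt0.
  by rewrite -powRrM mulrNN mulVf ?powRr1 ?gt_eqF// ltW.
near=> x; rewrite sub0r normrN ger0_norm ?powR_ge0//.
have Mx : M < x by near: x; apply: nbhs_pinfty_gt; exact: num_real.
have x0 : 0 < x by exact: lt_trans Mx.
rewrite !powRN ltf_pV2 ?posrE ?powR_gt0//.
by apply: (gt0_ltr_powR p0) => //; rewrite nnegrE ltW.
Unshelve. all: by end_near. Qed.

(** The difference quotient at 0 is eventually within 1 of [l]. This linear bound controls
    [Phi (s r)] by [s r] for large [r]. *)
Lemma derivable0_le_norm (f : R -> R) (l : R) : f 0 = 0 -> is_derive (0 : R) (1 : R) f l ->
  \forall s \near (0 : R), `|f s| <= (`|l| + 1) * `|s|.
Proof.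
move=> f0 [df fl].
have : h^-1 *: (f (h *: 1 + 0) - f 0) @[h --> 0^'] --> l by rewrite -fl.
move=> /cvgrPdist_lt/(_ 1 ltr01); rewrite /dnbhs/= near_withinE.
apply: filterS => h /=.
have [-> _|h0] := eqVneq h 0; first by rewrite f0 !normr0 mulr0.
move=> /(_ isT); rewrite /GRing.scale/= mulr1 addr0 f0 subr0 => hl.
have hf : `|h^-1 * f h| <= `|l| + 1.
  rewrite -[X in `|X|](subKr l) (le_trans (ler_normB _ _))// lerD2l ltW//.
by rewrite -[f h](mulVKf h0) normrM mulrC ler_wpM2r.
Qed.

(** The substitution [r = x ^+ 2 * k] is absorbed into the antiderivative
    [W (x ^+ 2 * k) / (2 * k)]. It vanishes at infinity, so only its value at [Num.sqrt (p / k)],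
    where [r = p], survives. *)
Lemma integral_radial_FTC (u W : R -> R) (p k : R) : 0 < p -> 0 < k ->
  (forall r, p <= r -> 0 <= u r) ->
  (forall r, p <= r -> is_derive r (1 : R) W (u r)) ->
  (forall r, p <= r -> {for r, continuous u}) ->
  W x @[x --> +oo] --> 0 ->
  (\int[mu]_(x in `]0%R, +oo[) ((if p < x ^+ 2 * k then u (x ^+ 2 * k) else 0) * x)%:E
    = (- W p / (2 * k))%:E)%E.
Proof.
move=> p0 k0 u0 dW cu Wy; pose a : R := Num.sqrt (p / k).
have a0 : 0 < a by rewrite sqrtr_gt0 divr_gt0.
have aE : a ^+ 2 * k = p by rewrite sqr_sqrtr ?divfK ?gt_eqF// ltW// divr_gt0.
have ale (x : R) : a <= x -> p <= x ^+ 2 * k.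
  by move=> ax; rewrite -aE ler_pM2r// lerXn2r// ?nnegrE ltW// (lt_le_trans a0).
transitivity (\int[mu]_(x in `]a, +oo[) (u (x ^+ 2 * k) * x)%:E)%E.
  rewrite integral_mkcond [RHS]integral_mkcond; apply: eq_integral => x _.
  rewrite !patchE !mem_setE !in_itv/= !andbT.
  have [x0|x0] := ltP 0 x; last by rewrite ifF// le_gtF// (le_trans x0)// ltW.
  rewrite -{1}aE ltr_pM2r// ltr_pXn2r ?nnegrE ?(ltW a0) ?(ltW x0)//.
  by case: ifPn => _//; rewrite mul0r.
have cf (x : R) : a <= x -> {for x, continuous (fun y : R => u (y ^+ 2 * k) * y)}.
  move=> ax; apply: cvgM; last exact: cvg_id.
  apply: (@continuous_comp _ _ _ (fun y : R => y ^+ 2 * k) u).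
    by apply: cvgMr_tmp; exact: exprn_continuous.
  exact/cu/ale.
rewrite integral_itv_obnd_cbnd; last first.
  apply/measurable_EFinP; apply: open_continuous_measurable_fun => //.
  by move=> x; rewrite inE/= in_itv/= andbT => /ltW/cf.
have dF (x : R) : a <= x -> is_derive x (1:R)
    (fun x => W (x ^+ 2 * k) / (2 * k)) (u (x ^+ 2 * k) * x).
  move=> ax; have d1 := dW _ (ale _ ax).
  have d2 : is_derive x (1:R) (fun x => x ^+ 2 * k) (2 * x * k).
    by apply: is_derive_eq; rewrite /GRing.scale/=; ring.
  have d3 : is_derive x (1:R) (fun x => W (x ^+ 2 * k)) (u (x ^+ 2 * k) * (2 * x * k)).
    exact: is_derive1_comp.
  apply: is_derive_eq; rewrite /GRing.scale/=; field.
  by rewrite gt_eqF.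
rewrite (@ge0_continuous_FTC2y R _ (fun x => W (x ^+ 2 * k) / (2 * k)) a 0).
- by rewrite aE -EFinB sub0r mulNr.
- by move=> x ax; rewrite mulr_ge0 ?u0 ?ale// (le_trans (ltW a0)).
- apply: continuous_in_subspaceT => x; rewrite inE/= in_itv/= andbT; exact: cf.
- rewrite -[X in _ --> X](mul0r (2 * k)^-1); apply: cvgMr_tmp.
  apply: (@cvg_comp _ _ _ (fun x => x ^+ 2 * k) W _ (pinfty_nbhs R)) => //.
  apply: gt0_cvgMly => //.
  exact: cvgr_expr2.
- by move=> x ax; have [] := dF _ (ltW ax).
- apply: cvg_at_right_filter.
  have [/derivable1_diffP/differentiable_continuous] := dF _ (lexx a).
  by [].
- move=> x; rewrite in_itv/= andbT => /ltW/dF[_ <-]; exact: derive1E.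
Qed.

End radial_integral.

(** * The radial profile of the Laplace exponent and its plane integral *)

Section hyp2F1_radial.
Context {R : realType}.
Notation mu := (@lebesgue_measure R).
Variables alpha rc z0 : R.
Hypotheses (alpha2 : 2 < alpha) (rc0 : 0 < rc) (z0_gt0 : 0 < z0).

(** The radial variable [r] is the squared norm, which halves the exponent [alpha]. The
    normalisation [z1] gives [s (rc ^+ 2) = z0], and [b * d = 1] matches the decay of [s] with the
    parameter of the differential equation. *)
Let b := alpha / 2.
Let d := 2 / alpha.
Let z1 := z0 * rc `^ alpha.
Let s (r : R) := z1 * r `^ (- b).
Let u (r : R) := s r / (1 + s r).

Definition outer_profile (r : R) := if rc ^+ 2 < r then u r else 0.

Let alpha0 : 0 < alpha. Proof. exact: lt_trans alpha2. Qed.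
Let b1 : 1 < b. Proof. by rewrite /b ltr_pdivlMr// mul1r. Qed.
Let d01 : 0 < d < 1.
Proof. by rewrite /d divr_gt0//= ltr_pdivrMr// mul1r. Qed.
Let bd : b * d = 1.
Proof. by rewrite /b /d; field; rewrite gt_eqF. Qed.
Let z1_gt0 : 0 < z1. Proof. by rewrite mulr_gt0// powR_gt0. Qed.
Let p0 : 0 < rc ^+ 2. Proof. exact: exprn_gt0. Qed.
Let s_ge0 (r : R) : 0 <= s r. Proof. by rewrite mulr_ge0 ?powR_ge0// ltW. Qed.

Let powR_cond (x e : R) : 0 < x -> (e == 0) ==> (x != 0).
Proof. by move=> x0; rewrite (gt_eqF x0) implybT. Qed.

Let s_rc : s (rc ^+ 2) = z0.
Proof.
rewrite /s /z1 -powR_mulrn ?(ltW rc0)// -powRrM mulrN.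
have -> : 2%:R * b = alpha by rewrite /b mulrCA divff ?mulr1.
by rewrite -mulrA -powRD ?powR_cond// subrr powRr0 mulr1.
Qed.

Let s_le (r : R) : rc ^+ 2 <= r -> s r <= z0.
Proof.
move=> pr; have r0 : 0 < r by exact: lt_le_trans pr.
rewrite -s_rc /s ler_pM2l// !powRN lef_pV2 ?posrE ?powR_gt0//.
by apply: ge0_ler_powR => //; rewrite ?nnegrE ltW// (lt_trans ltr01).
Qed.

Let is_derive_s (r : R) : 0 < r -> is_derive r (1 : R) s (- b * s r / r).
Proof.
move=> r0; have d1 := is_derive1_powR (- b) r0.
apply: is_derive_eq; rewrite /GRing.scale/= /s.
by rewrite powRD ?powR_cond// [r `^ (- 1)]powRN powRr1 ?(ltW r0)//; ring.
Qed.

Let cvgy_s : s r @[r --> +oo] --> 0.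
Proof.
rewrite -[X in _ --> X](mulr0 z1); apply: cvgMl_tmp; apply: cvgy_powRN.
exact: lt_trans b1.
Qed.

Let continuous_u (r : R) : rc ^+ 2 <= r -> {for r, continuous u}.
Proof.
move=> pr; have r0 : 0 < r by exact: lt_le_trans pr.
have cs : {for r, continuous s}.
  by have [/derivable1_diffP/differentiable_continuous] := is_derive_s r0.
apply: cvgM => //; apply: cvgV.
  by rewrite gt_eqF// ltr_wpDr.
by apply: cvgD => //; exact: cvg_cst.
Qed.

Lemma measurable_outer_profile : measurable_fun [set: R] outer_profile.
Proof.
have ms : measurable_fun [set: R] s.
  by apply: measurable_funM => //; exact: measurable_powR.
apply: measurable_fun_ifT => //.
  exact: measurable_fun_ltr.
rewrite (_ : u = fun r => s r * (1 + s r) `^ (- 1)); last first.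
  by apply/funext => r; rewrite powR_inv1// addr_ge0.
apply: measurable_funM => //.
apply: (measurableT_comp (measurable_powR (- 1))).
exact: measurable_funD.
Qed.

Lemma outer_profile_ge0 (r : R) : 0 <= outer_profile r.
Proof.
by rewrite /outer_profile; case: ifP => // _; rewrite divr_ge0// addr_ge0.
Qed.

Lemma integral_outer_profile :
  (\int[mu]_x1 \int[mu]_x2 (outer_profile (x1 ^+ 2 + x2 ^+ 2))%:E =
   (pi * (rc ^+ 2 * (hyp2F1 (- (2 / alpha)) 1 (1 - 2 / alpha) (- z0) - 1)))%:E)%E.
Proof.
apply: ge0_integral_plane_radial.
- exact: measurable_outer_profile.
- exact: outer_profile_ge0.
move=> k k0; have [Phi [dPhi [Phi0 Phiz PhiE]]] := hyp2F1_ode d01 z0_gt0.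
rewrite -[2 / alpha]/d -Phiz.
have -> : rc ^+ 2 * Phi z0 = - (- (rc ^+ 2 * Phi (s (rc ^+ 2)))).
  by rewrite opprK s_rc.
apply: (@integral_radial_FTC R u (fun r => - (r * Phi (s r)))) => //.
- by move=> r _; rewrite divr_ge0// addr_ge0.
- move=> r pr; have r0 : 0 < r by exact: lt_le_trans pr.
  have sz : 0 <= s r <= z0 by rewrite s_ge0 s_le.
  have [dP PE] := PhiE _ sz.
  have ds := is_derive_s r0.
  have dc : is_derive r (1:R) (fun r => Phi (s r)) (dPhi (s r) * (- b * s r / r)).
    exact: is_derive1_comp.
  apply: is_derive_eq; rewrite /GRing.scale/=.
  (* Since [s' = - b * s / r], the differential equation applies, and [b * d = 1] cancels [Phi],
     leaving [s / (1 + s)]. *)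
  transitivity (b * (s r * dPhi (s r)) - Phi (s r)).
    by field; rewrite gt_eqF.
  by rewrite PE -mulrDr mulrA bd mul1r addrAC subrr add0r.
have [dP _] : is_derive (0:R) (1:R) Phi (dPhi 0) /\
    0 * dPhi 0 = d * Phi 0 + d * (0 / (1 + 0)).
  by apply: PhiE; rewrite lexx ltW.
have := derivable0_le_norm Phi0 dP; set C := _ + 1 => nC.
have C0 : 0 <= C by rewrite addr_ge0.
have nCs : \forall x \near +oo, `|Phi (s x)| <= C * `|s x| by exact: (cvgy_s nC).
(* This majorant of [x * Phi (s x)] tends to 0 because [alpha > 2] makes [b > 1]. *)
have gy : C * z1 * x `^ (- (b - 1)) @[x --> +oo] --> 0.
  rewrite -[X in _ --> X](mulr0 (C * z1)); apply: cvgMl_tmp; apply: cvgy_powRN.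
  by rewrite subr_gt0.
move/cvgrPdist_lt : gy => gy.
apply/cvgrPdist_lt => e e0; near=> x.
have x0 : 0 < x by near: x; apply: nbhs_pinfty_gt; exact: num_real.
have sC : `|Phi (s x)| <= C * `|s x| by near: x.
apply: (@le_lt_trans _ _ `|0 - C * z1 * x `^ (- (b - 1))|); last by near: x; exact: gy.
have h : 0 <= C * z1 * x `^ (- (b - 1)) by rewrite !mulr_ge0 ?powR_ge0// ltW.
rewrite !sub0r opprK normrN (ger0_norm h) normrM (gtr0_norm x0).
apply: (le_trans (ler_wpM2l (ltW x0) sC)).
rewrite ger0_norm// /s opprB addrC powRD ?powR_cond//.
by rewrite powRr1 ?(ltW x0)// le_eqVlt; apply/orP; left; apply/eqP; ring.
Unshelve. all: by end_near. Qed.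

End hyp2F1_radial.

(** * The intensity measure of the marked process *)

Section plane_measure.
Context {R : realType}.
Notation mu := (@lebesgue_measure R).

(** The product is named so that its sigma-finite structure can be declared; the space of marked
    points is then a product of the plane with the mark axis. *)
Definition plane_measure : set (measurableTypeR R * measurableTypeR R) -> \bar R :=
  (mu \x mu)%E.

HB.instance Definition _ := Measure.on plane_measure.

Let plane_measure_sigma_finite : sigma_finite setT plane_measure.
Proof.
have /sigma_finiteP[F [TF ndF Foo]] := sigma_finiteT mu.
exists (fun n => F n `*` F n).
  rewrite -setXTT TF predeqE => -[x y]; split.
    move=> [/= [n _ Fnx] [k _ Fky]]; exists (maxn n k) => //; split.
    - by move: x Fnx; exact/subsetPset/ndF/leq_maxl.
    - by move: y Fky; exact/subsetPset/ndF/leq_maxr.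
  by move=> [n _ []/= ? ?]; split; exists n.
move=> k; have [mF Fk] := Foo k; split; first exact: measurableX.
by rewrite /plane_measure product_measure1E// lte_mul_pinfty// ge0_fin_numE.
Qed.

HB.instance Definition _ :=
  Measure_isSigmaFinite.Build _ _ _ plane_measure plane_measure_sigma_finite.

End plane_measure.

Section intensity.
Context {R : realType}.
Notation mu := (@lebesgue_measure R).
Notation marked_plane := ((measurableTypeR R * measurableTypeR R) * measurableTypeR R)%type.
Local Notation mu3 := (@plane_measure R \x mu)%E.
Variables lam rc : R.

Definition mppp_density (y : (R * R) * R) : R :=
  \1_[set x | rc < norm2 x] y.1 * \1_[set h | 0 <= h] y.2 * expR (- y.2).

Lemma mppp_density_ge0 y : 0 <= mppp_density y.
Proof. by rewrite /mppp_density !mulr_ge0 ?expR_ge0// indicE ler0n. Qed.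

Lemma measurable_norm2 : measurable_fun [set: R * R] (@norm2 R).
Proof.
apply: (@measurableT_comp _ _ _ _ _ _ (@Num.sqrt R)).
  by apply: continuous_measurable_fun; exact: sqrt_continuous.
by apply: measurable_funD; exact: measurable_funX.
Qed.

Lemma measurable_mppp_density :
  measurable_fun [set: (R * R) * R] mppp_density.
Proof.
apply: measurable_funM; first apply: measurable_funM.
- apply: (@measurableT_comp _ _ _ _ _ _
    (\1_[set x : R * R | rc < norm2 x] : R * R -> R)) => //.
  apply: measurable_indic.
  have -> : [set x : R * R | rc < norm2 x] = [set: R * R] `&` norm2 @^-1` `]rc, +oo[%classic.
    by rewrite setTI; apply/seteqP; split => x /=; rewrite in_itv/= andbT.
  by apply: measurable_norm2 => //; exact: measurable_itv.
- apply: (@measurableT_comp _ _ _ _ _ _ (\1_[set h : R | 0 <= h] : R -> R)) => //.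
  apply: measurable_indic; rewrite -set_itvcy; exact: measurable_itv.
- by apply: measurableT_comp => //; apply: measurableT_comp.
Qed.

(** Integration against the intensity measure, as one integral with a density over a product
    measure: linearity and monotone convergence apply directly, and Tonelli recovers the iterated
    form. *)
Definition mppp_integral (g : (R * R) * R -> R) : \bar R :=
  (lam%:E * \int[mu3]_y (g y * mppp_density y)%:E)%E.

Lemma mppp_integral_iter (g : (R * R) * R -> R) :
  measurable_fun [set: (R * R) * R] g -> (forall y, 0 <= g y) ->
  mppp_integral g =
  (lam%:E * \int[mu]_x1 \int[mu]_x2 \int[mu]_(h in [set h : R | (0 <= h)%R])
    (g ((x1, x2), h) * \1_[set x | (rc < norm2 x)%R] (x1, x2) * expR (- h))%:E)%E.
Proof.
move=> mg g0; rewrite /mppp_integral; congr (_ * _)%E.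
have h0 (y : marked_plane) : (0 <= (g y * mppp_density y)%:E)%E.
  by rewrite lee_fin mulr_ge0// mppp_density_ge0.
have mh : measurable_fun [set: marked_plane] (fun y => (g y * mppp_density y)%:E).
  by apply/measurable_EFinP; apply: measurable_funM => //; exact: measurable_mppp_density.
have mF := @measurable_fun_fubini_tonelli_F _ _ _ _ R mu _ mh h0.
have F0 x : (0 <= fubini_F mu (fun y => (g y * mppp_density y)%:E) x)%E.
  by apply: integral_ge0.
transitivity (\int[@plane_measure R]_x fubini_F mu (fun y => (g y * mppp_density y)%:E) x)%E.
  exact: (@fubini_tonelli1 _ _ _ _ R (@plane_measure R) mu _ mh h0).
transitivity (\int[mu]_x fubini_F mu (fubini_F mu (fun y => (g y * mppp_density y)%:E)) x)%E.
  exact: (@fubini_tonelli1 _ _ _ _ R mu mu _ mF F0).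
apply: eq_integral => x1 _; apply: eq_integral => x2 _.
rewrite /fubini_F [RHS]integral_mkcond; apply: eq_integral => h _.
rewrite patchE /mppp_density [\1_[set h | 0 <= h] _]indicE [_.1]/= [_.2]/=.
by case: (h \in _); rewrite ?mulr1 ?mulr0 ?mul0r ?mulr0// mulrA.
Qed.

Lemma mppp_intensityE (A : set ((R * R) * R)) : measurable A ->
  mppp_intensity lam rc A = mppp_integral \1_A.
Proof.
by move=> mA; rewrite mppp_integral_iter.
Qed.

(** The value is 1 minus the Laplace transform [1 / (1 + a)] of an Exp(1) mark. *)
Lemma integral_exp_laplace (a : R) : 0 <= a ->
  (\int[mu]_(h in [set h : R | (0 <= h)%R]) ((1 - expR (- (a * h))) * expR (- h))%:E
   = (a / (1 + a))%:E)%E.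
Proof.
move=> a0; have a1 : 0 < 1 + a by rewrite ltr_wpDr.
pose F (h : R) := expR (- ((1 + a) * h)) / (1 + a) - expR (- h).
have dF (x : R) : is_derive x (1:R) F ((1 - expR (- (a * x))) * expR (- x)).
  apply: is_derive_eq; rewrite /GRing.scale/=.
  rewrite mulrBl mul1r -expRD -opprD.
  have -> : a * x + x = (1 + a) * x by ring.
  field; by rewrite gt_eqF.
rewrite -set_itvcy (@ge0_continuous_FTC2y R _ F 0 0).
- rewrite -EFinB /F !mulr0 oppr0 expR0; congr EFin; field; by rewrite gt_eqF.
- move=> x x0; rewrite mulr_ge0 ?expR_ge0// subr_ge0 -expR0 ler_expR oppr_le0.
  by rewrite mulr_ge0.
- apply: continuous_subspaceT => x; apply: cvgM.
    apply: cvgB; first exact: cvg_cst.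
    apply: continuous_comp; last exact: continuous_expR.
    by apply: cvgN; apply: cvgMl_tmp; exact: cvg_id.
  apply: continuous_comp; last exact: continuous_expR.
  by apply: cvgN; exact: cvg_id.
- rewrite -[X in _ --> X](subr0 0) -[X in _ --> X - _](mul0r (1 + a)^-1).
  apply: cvgB; last exact: cvgr_expR.
  apply: cvgMr_tmp.
  apply: (@cvg_comp _ _ _ (fun x => (1 + a) * x) (fun x => expR (- x)) _ (pinfty_nbhs R)).
    by apply: gt0_cvgMry.
  exact: cvgr_expR.
- by move=> x _; have [] := dF x.
- apply: cvg_at_right_filter.
  by have [/derivable1_diffP/differentiable_continuous] := dF 0.
- by move=> x _; rewrite derive1E; have [_ ->] := dF x.
Qed.

End intensity.

(** * The Laplace exponent of the path gain *)

Section intensity_laplace.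
Context {R : realType}.
Variables lam rc alpha z0 : R.
Hypotheses (rc0 : 0 < rc) (alpha2 : 2 < alpha) (z0_gt0 : 0 < z0).

(* Truncating the mark at [0] makes the path gain nonnegative off the null set
   of negative marks. *)
Definition path_gain (c : R) (y : (R * R) * R) : R :=
  c * norm2 y.1 `^ (- alpha) * maxr y.2 0.

Lemma path_gain_ge0 (c : R) y : 0 <= c -> 0 <= path_gain c y.
Proof.
by move=> c0; rewrite /path_gain !mulr_ge0 ?powR_ge0// le_max lexx orbT.
Qed.

Lemma measurable_path_gain (c : R) : measurable_fun [set: (R * R) * R] (path_gain c).
Proof.
apply: measurable_funM.
  apply: measurable_funM => //.
  apply: (measurableT_comp (measurable_powR (- alpha))).
  exact: (measurableT_comp measurable_norm2).
exact: measurable_maxr.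
Qed.

Lemma measurable_laplace_path_gain (c : R) :
  measurable_fun [set: (R * R) * R] (fun y => 1 - expR (- path_gain c y)).
Proof.
apply: measurable_funB => //; apply: measurableT_comp => //.
by apply: measurableT_comp => //; exact: measurable_path_gain.
Qed.

Lemma laplace_path_gain_ge0 (c : R) y : 0 <= c -> 0 <= 1 - expR (- path_gain c y).
Proof.
by move=> c0; rewrite subr_ge0 -expR0 ler_expR oppr_le0 path_gain_ge0.
Qed.

Lemma mppp_integral_laplace :
  mppp_integral lam rc (fun y => 1 - expR (- path_gain (z0 * rc `^ alpha) y)) =
  (lam * (pi * (rc ^+ 2 *
    (hyp2F1 (- (2 / alpha)) 1 (1 - 2 / alpha) (- z0) - 1))))%:E.
Proof.
have c0 : 0 <= z0 * rc `^ alpha by rewrite mulr_ge0 ?powR_ge0// ltW.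
rewrite mppp_integral_iter//; last 2 first.
- exact: measurable_laplace_path_gain.
- by move=> y; exact: laplace_path_gain_ge0.
rewrite EFinM -(integral_outer_profile alpha2 rc0 z0_gt0); congr (_ * _)%E.
apply: eq_integral => x1 _; apply: eq_integral => x2 _.
rewrite /outer_profile /path_gain/=.
set r := x1 ^+ 2 + x2 ^+ 2.
have r0 : 0 <= r by rewrite addr_ge0// sqr_ge0.
have nE : norm2 (x1, x2) = Num.sqrt r by [].
have -> : \1_[set x : R * R | rc < norm2 x] (x1, x2) = (rc ^+ 2 < r)%R%:R :> R.
  have e : (rc < Num.sqrt r) = (rc ^+ 2 < r).
    by rewrite -{2}(sqr_sqrtr r0) ltr_pXn2r// nnegrE ?sqrtr_ge0// ltW.
  rewrite indicE; congr (nat_of_bool _)%:R; apply/idP/idP => [/set_mem/=|h].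
    by rewrite nE e.
  by apply/mem_set; rewrite /= nE e.
case: ifPn => rr; last first.
  by rewrite integral0_eq// => h _; rewrite mulr0 mul0r.
have -> : norm2 (x1, x2) `^ (- alpha) = r `^ (- (alpha / 2)).
  by rewrite nE -powR12_sqrt// -powRrM; congr (_ `^ _); field.
set s := z0 * _ * _.
rewrite -integral_exp_laplace; last by rewrite mulr_ge0// powR_ge0.
apply: eq_integral => h; rewrite inE/= => h0.
by rewrite mulr1 (max_idPl h0).
Qed.

End intensity_laplace.

(** * Counting points *)

Section exponential_tail.
Context {R : realType}.

Lemma exponential_prob_itvcy (t : R) : 0 <= t ->
  exponential_prob 1 `[t, +oo[%classic = (expR (- t))%:E.
Proof.
move=> t0; rewrite /exponential_prob.
rewrite (@ge0_continuous_FTC2y R _ (fun x => - expR (- 1 * x)) t 0).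
- by rewrite -EFinB sub0r opprK mulN1r.
- by move=> x _; exact: exponential_pdf_ge0.
- apply: (@continuous_subspaceW R^o _ _ [set` `[0, +oo[%R]).
    by apply: subset_itvr; rewrite bnd_simp.
  exact: within_continuous_exponential_pdf.
- rewrite -oppr0; apply: cvgN; under eq_fun do rewrite mulN1r; exact: cvgr_expR.
- by move=> x _; exact: ex_derive.
- apply: cvg_at_right_filter; apply: cvgN.
  apply: continuous_comp; last exact: continuous_expR.
  by apply: cvgMl_tmp; exact: cvg_id.
- move=> x; rewrite in_itv/= andbT => tx; apply: derive1_exponential_pdf.
  by rewrite in_itv/= andbT (le_lt_trans t0).
Qed.

(** The Poisson generating function at [x], from the exponential series at [m * x]; [K] will hold
    the factors of all other counts and of [G]. *)
Lemma nneseries_poisson_pgf (m x K : R) :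
  (\sum_(n <oo) (K * (x ^+ n * poisson_pk m n))%:E = (K * expR (- (m * (1 - x))))%:E)%E.
Proof.
apply/cvg_lim => //.
have -> : (fun n => \sum_(0 <= i < n) (K * (x ^+ i * poisson_pk m i))%:E)%E =
    EFin \o (fun n => K * expR (- m) * series (exp_coeff (m * x)) n).
  apply/funext => n; rewrite /= sumEFin /series/= mulr_sumr; congr EFin.
  by apply: eq_bigr => i _; rewrite /poisson_pk /exp_coeff/= exprMn; ring.
have -> : K * expR (- (m * (1 - x))) = K * expR (- m) * expR (m * x).
  by rewrite -mulrA -expRD; congr (_ * expR _); ring.
apply: cvg_EFin; first exact: nearW.
by apply: cvgMl_tmp; exact: is_cvg_series_exp_coeff.
Qed.

End exponential_tail.

Section counting.
Context {d} {T : measurableType d} {R : realType}.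
Variables (X : nat -> T -> R * R) (H : nat -> T -> R).
Local Open Scope ereal_scope.

Lemma mcount_ge0 A w : 0 <= mcount X H A w.
Proof. by apply: nneseries_ge0 => n _ _; rewrite lee_fin. Qed.

(** The partial sums are natural numbers bounded by a finite total, so they attain a maximum, and
    this maximum is the sum. *)
Lemma mcount_nat A w : mcount X H A w < +oo ->
  exists n : nat, mcount X H A w = n%:R%:E.
Proof.
move=> Noo; pose c m := (\sum_(0 <= i < m) (((X i w, H i w) \in A) : nat))%N.
have cE m : \sum_(0 <= i < m) (\1_A (X i w, H i w) : R)%:E = (c m)%:R%:E.
  by rewrite sumEFin /c natr_sum; congr EFin.
have N0 i : (0 <= i)%N -> true -> 0 <= (\1_A (X i w, H i w) : R)%:E.
  by move=> _ _; rewrite lee_fin.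
have cN m : (c m)%:R%:E <= mcount X H A w.
  by rewrite -cE; exact: nneseries_lim_ge.
have Nfin : mcount X H A w \is a fin_num by rewrite ge0_fin_numE// mcount_ge0.
have cM m : xpredT m -> (c m <= Num.truncn (fine (mcount X H A w)))%N.
  move=> _; rewrite truncn_ge_nat; last by rewrite fine_ge0// mcount_ge0.
  by rewrite -lee_fin fineK.
pose vals := [pred v : nat | `[< exists m, c m = v >]].
have ex0 : exists v, vals v by exists (c 0%N); apply/asboolP; exists 0%N.
have bnd v : vals v -> (v <= Num.truncn (fine (mcount X H A w)))%N.
  by move=> /asboolP[m <-]; exact: cM.
have [v /asboolP[m0 m0v] vmax] := ex_maxnP ex0 bnd.
exists v; apply/eqP; rewrite eq_le -{2}m0v cN andbT.
apply: lime_le; first exact: is_cvg_nneseries.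
by apply: nearW => m; rewrite cE lee_fin ler_nat vmax//; apply/asboolP; exists m.
Qed.

Hypotheses (mX : forall n, measurable_fun [set: T] (X n))
  (mH : forall n, measurable_fun [set: T] (H n)).

Lemma measurable_point n : measurable_fun [set: T] (fun w => (X n w, H n w)).
Proof. exact: measurable_fun_pair. Qed.

Lemma measurable_point_sum (f : (R * R) * R -> R) :
  measurable_fun [set: (R * R) * R] f -> (forall y, 0 <= f y)%R ->
  measurable_fun [set: T] (fun w => \sum_(n <oo) (f (X n w, H n w))%:E).
Proof.
move=> mf f0; apply: ge0_emeasurable_sum => [n w _ _|n _].
  by rewrite lee_fin.
by apply/measurable_EFinP; apply: measurableT_comp => //; exact: measurable_point.
Qed.

Lemma measurable_mcount A : measurable A -> measurable_fun [set: T] (mcount X H A).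
Proof. by move=> mA; apply: measurable_point_sum. Qed.

End counting.

(** * Laplace functional for step functions *)

Section poisson_step.
Context {d} {T : measurableType d} {R : realType} (P : probability T R).
Variables (lam rc : R) (X : nat -> T -> R * R) (H : nat -> T -> R) (G : T -> R).
Hypothesis hP : marked_ppp_indep P lam rc X H G.

Let mX n : measurable_fun [set: T] (X n). Proof. by case: hP. Qed.
Let mH n : measurable_fun [set: T] (H n). Proof. by case: hP. Qed.
Let mG : measurable_fun [set: T] G. Proof. by case: hP. Qed.

Lemma prob_fading_ge (t : R) : 0 <= t ->
  P (G @^-1` `[t, +oo[%classic) = (expR (- t))%:E.
Proof.
move=> t0; case: hP => _ _ _ hG _.
by rewrite hG ?exponential_prob_itvcy//; exact: measurable_itv.
Qed.

Section slices.
Variables (k : nat) (A : 'I_k -> set ((R * R) * R)) (c : 'I_k -> R).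
Hypotheses (mA : forall i, measurable (A i))
  (finA : forall i, (mppp_intensity lam rc (A i) < +oo)%E)
  (disjA : forall i j, i != j -> A i `&` A j = set0)
  (c0 : forall i, 0 < c i).

Let N i w := mcount X H (A i) w.
Let m i := fine (mppp_intensity lam rc (A i)).

Let mN i : measurable_fun [set: T] (N i). Proof. exact: measurable_mcount. Qed.

(* The counts of index [< j] are weighted by [c] and those of index [>= j] are
   prescribed; moving [j] from [0] to [k] integrates the counts one at a time. *)
Let slice (j : nat) (t : R) (ns : 'I_k -> nat) : set T :=
  [set w | (\sum_(i < k | (i < j)%N) (c i)%:E * N i w + t%:E <= (G w)%:E)%E] `&`
  \bigcap_(i in [set i : 'I_k | (j <= i)%N]) [set w | N i w = (ns i)%:R%:E].

Let measurable_slice j t ns : measurable (slice j t ns).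
Proof.
apply: measurableI.
  rewrite -[X in measurable X]setTI; apply: measurable_lee => //.
    apply: emeasurable_funD => //;
    apply: (eq_measurable_fun (fun w =>
        \sum_(i < k) (if (i < j)%N then (c i)%:E * N i w else 0))%E) => [w _|].
      by rewrite [RHS]big_mkcond.
    apply: emeasurable_sum => i; case: (i < j)%N => //.
    exact: measurable_funeM.
  exact/measurable_EFinP.
apply: fin_bigcap_measurable => // i _.
by rewrite -[X in measurable X]setTI; apply: measurable_eqe.
Qed.

(** As [c i0 > 0] and [G] is real, the event forces the count of index [i0] to be finite, hence some
    natural number [n]; its contribution [c i0 * n] then moves into the threshold. *)
Let slice_recr (i0 : 'I_k) t ns :
  slice i0.+1 t ns = \bigcup_(n in [set: nat])
    slice i0 (t + c i0 * n%:R) (fun i => if i == i0 then n else ns i).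
Proof.
have sumE w : (\sum_(i < k | (i < i0.+1)%N) (c i)%:E * N i w =
    (c i0)%:E * N i0 w + \sum_(i < k | (i < i0)%N) (c i)%:E * N i w)%E.
  rewrite (bigD1 i0)//=; congr (_ + _)%E; apply: eq_bigl => i.
  by rewrite ltnS ltn_neqAle andbC.
have S0 w : (0 <= \sum_(i < k | (i < i0)%N) (c i)%:E * N i w)%E.
  by apply: sume_ge0 => i _; rewrite mule_ge0 ?mcount_ge0// lee_fin ltW.
apply/seteqP; split => w.
  move=> [/= hs hn].
  have Noo : (N i0 w < +oo)%E.
    rewrite ltey; apply/eqP => Noo; move: hs.
    rewrite sumE Noo gt0_muley ?lte_fin// addye; last first.
      by rewrite gt_eqF// (lt_le_trans _ (S0 w)).
    by rewrite addye.
  have [n Nn] := mcount_nat Noo.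
  exists n => //; split => /=.
    by move: hs; rewrite sumE /N Nn -/N EFinD EFinM -addeA addeC -addeA [X in (_ + X)%E]addeC.
  move=> i /=; case: eqVneq => [->//|ii0] i0i; apply: hn => /=.
  by rewrite ltn_neqAle i0i andbT; apply: contra ii0 => /eqP/val_inj ->.
move=> [n _ [/= hs hn]]; have Nn : N i0 w = n%:R%:E.
  by have := hn i0 (leqnn _); rewrite /= eqxx.
split => /=.
  by rewrite sumE Nn -addeA addeC -addeA -EFinM -EFinD.
move=> i /= ii0; have := hn i (ltnW ii0) => /=.
by rewrite ifF//; apply/negbTE; apply: contraTneq ii0 => ->; rewrite ltnn.
Qed.

(** For [j = 0] this is the hypothesis on the process with [B = [t, +oo[]. Each further step sums
    over the value [n] of one count; the pieces are disjoint, and the sum is a Poisson generating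
    function at [expR (- c i0)]. *)
Let slice_prob j t ns : (j <= k)%N -> 0 <= t ->
  P (slice j t ns) = (expR (- t) * \prod_(i < k)
    (if (i < j)%N then expR (- (m i * (1 - expR (- c i))))
     else poisson_pk (m i) (ns i)))%:E.
Proof.
elim: j t ns => [|j ih] t ns jk t0.
  have sE : slice 0 t ns = G @^-1` `[t, +oo[%classic `&`
      \bigcap_(i in [set: 'I_k]) [set w | mcount X H (A i) w = (ns i)%:R%:E].
    congr (_ `&` _); last by apply: eq_bigcapl => //; split => i.
    apply/funext => w; apply: propext.
    by rewrite /preimage/= big_pred0// add0e lee_fin in_itv/= andbT.
  have [_ _ _ _ hI] := hP.
  have := hI k A ns `[t, +oo[%classic mA finA disjA (measurable_itv _).
  by rewrite -sE => ->; rewrite prob_fading_ge// prodEFin EFinM.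
pose i0 := Ordinal jk.
rewrite -[j.+1]/(i0 : nat).+1 slice_recr measure_bigcup//=; last first.
  apply/trivIsetP => a b _ _ ab; apply/seteqP; split => // w [[_ ha] [_ hb]].
  have := ha i0 (leqnn _); have := hb i0 (leqnn _); rewrite /= eqxx => -> [] /eqP.
  by rewrite eqr_nat eq_sym (negbTE ab).
pose Q := \prod_(i < k | i != i0) (if (i < j.+1)%N then expR (- (m i * (1 - expR (- c i))))
     else poisson_pk (m i) (ns i)).
transitivity (\sum_(n <oo) ((expR (- t) * Q) *
    (expR (- c i0) ^+ n * poisson_pk (m i0) n))%:E)%E.
  rewrite (@eq_eseriesl _ _ xpredT); last by move=> n; rewrite in_setT.
  apply: eq_eseriesr => n _; rewrite ih ?(ltnW jk)//; last by rewrite addr_ge0// mulr_ge0// ltW.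
  congr EFin; rewrite (bigD1 i0)//= ltnn eqxx opprD expRD.
  have -> : \prod_(i < k | i != i0) (if (i < j)%N then expR (- (m i * (1 - expR (- c i))))
     else poisson_pk (m i) (if i == i0 then n else ns i)) = Q.
    apply: eq_bigr => i ii0; rewrite (negbTE ii0).
    have -> // : (i < j.+1)%N = (i < j)%N.
    rewrite ltnS leq_eqVlt; case: eqP => // e; case/eqP: ii0; exact/val_inj.
  have -> : expR (- (c i0 * n%:R)) = expR (- c i0) ^+ n.
    by rewrite -mulNr mulrC expRM_natl.
  ring.
rewrite nneseries_poisson_pgf; congr EFin.
by rewrite [in RHS](bigD1 i0)//= ltnSn -/Q mulrA mulrAC.
Qed.

Lemma prob_weighted_counts t : 0 <= t ->
  P [set w | (\sum_(i < k) (c i)%:E * mcount X H (A i) w + t%:E <= (G w)%:E)%E] =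
  (expR (- t) * \prod_(i < k) expR (- (fine (mppp_intensity lam rc (A i)) *
    (1 - expR (- c i)))))%:E.
Proof.
(* At [j = k] no count is prescribed any more, so the values 0 are a dummy choice. *)
move=> t0; have := slice_prob (fun=> 0%N) (leqnn k) t0.
have -> : slice k t (fun=> 0%N) =
  [set w | (\sum_(i < k) (c i)%:E * mcount X H (A i) w + t%:E <= (G w)%:E)%E].
  rewrite /slice (_ : [set i : 'I_k | (k <= i)%N] = set0).
    rewrite bigcap_set0 setIT; apply/funext => w; apply: propext => /=.
    by rewrite (eq_bigl xpredT)// => i; rewrite ltn_ord.
  by apply/seteqP; split => // i /=; rewrite leqNgt ltn_ord.
by move=> ->; congr (_ * _)%:E; apply: eq_bigr => i _; rewrite ltn_ord.
Qed.

End slices.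
End poisson_step.

(** * Integration against the intensity measure *)

Section mppp_integral_theory.
Context {R : realType}.
Notation mu3 := (@plane_measure R \x @lebesgue_measure R)%E.
Variables lam rc : R.
Hypothesis lam0 : 0 <= lam.
Implicit Types f g : (R * R) * R -> R.

Let wge0 g y : (forall y, 0 <= g y) -> (0 <= (g y * mppp_density rc y)%:E)%E.
Proof. by move=> g0; rewrite lee_fin mulr_ge0// mppp_density_ge0. Qed.

Let wmeas g : measurable_fun [set: (R * R) * R] g ->
  measurable_fun [set: (R * R) * R] (fun y => (g y * mppp_density rc y)%:E).
Proof.
move=> mg; apply/measurable_EFinP; apply: measurable_funM => //.
exact: measurable_mppp_density.
Qed.

Lemma mppp_integral_ge0 g : (forall y, 0 <= g y) -> (0 <= mppp_integral lam rc g)%E.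
Proof.
move=> g0; apply: mule_ge0; first by rewrite lee_fin.
by apply: integral_ge0 => y _; exact: wge0.
Qed.

Lemma le_mppp_integral f g :
  measurable_fun [set: (R * R) * R] f -> measurable_fun [set: (R * R) * R] g ->
  (forall y, 0 <= f y <= g y) ->
  (mppp_integral lam rc f <= mppp_integral lam rc g)%E.
Proof.
move=> mf mg fg; apply: lee_wpmul2l; first by rewrite lee_fin.
apply: ge0_le_integral => //.
- by move=> y _; apply: wge0 => z; case/andP: (fg z).
- exact: wmeas.
- exact: wmeas.
- move=> y _; rewrite lee_fin ler_wpM2r ?mppp_density_ge0//.
  by case/andP: (fg y).
Qed.

Lemma mppp_integral_sumZ n (a : 'I_n -> R) (g : 'I_n -> (R * R) * R -> R) :
  (forall i, 0 <= a i) -> (forall i, measurable_fun [set: (R * R) * R] (g i)) ->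
  (forall i y, 0 <= g i y) ->
  mppp_integral lam rc (fun y => \sum_(i < n) a i * g i y) =
  (\sum_(i < n) (a i)%:E * mppp_integral lam rc (g i))%E.
Proof.
move=> a0 mg g0; rewrite /mppp_integral.
transitivity (lam%:E * \int[mu3]_y
   (\sum_(i < n) (a i)%:E * (g i y * mppp_density rc y)%:E))%E.
  congr (_ * _)%E; apply: eq_integral => y _.
  by rewrite mulr_suml -sumEFin; apply: eq_bigr => i _; rewrite -mulrA EFinM.
rewrite ge0_integral_sum//; last 2 first.
- by move=> i; apply: measurable_funeM; exact: wmeas.
- by move=> i y _; rewrite mule_ge0// ?lee_fin// -lee_fin; exact: wge0.
rewrite ge0_sume_distrr; last first.
  move=> i _; apply: integral_ge0 => y _.
  by rewrite mule_ge0// ?lee_fin// -lee_fin; exact: wge0.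
apply: eq_bigr => i _; rewrite ge0_integralZl_EFin//.
- by rewrite muleCA.
- by move=> y _; exact: wge0.
- exact: wmeas.
Qed.

Lemma cvg_mppp_integral (f : (R * R) * R -> R) (g : nat -> (R * R) * R -> R) :
  (forall n, measurable_fun [set: (R * R) * R] (g n)) ->
  (forall n y, 0 <= g n y) ->
  (forall y, {homo g^~ y : n m / (n <= m)%N >-> n <= m}) ->
  (forall y, g n y @[n --> \oo] --> f y) ->
  mppp_integral lam rc (g n) @[n --> \oo] --> mppp_integral lam rc f.
Proof.
move=> mg g0 ndg gf; rewrite /mppp_integral.
apply: cvgeZl => //.
have -> : (\int[mu3]_y (f y * mppp_density rc y)%:E)%E =
  (\int[mu3]_y limn (fun n => (g n y * mppp_density rc y)%:E))%E.
  apply: eq_integral => y _; apply/esym/cvg_lim => //.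
  apply: cvg_EFin; first exact: nearW.
  exact: cvgMr_tmp.
apply: cvg_monotone_convergence => //.
- by move=> n; exact: wmeas.
- by move=> n y _; exact: wge0.
- by move=> y _ n m nm; rewrite lee_fin ler_wpM2r ?mppp_density_ge0//; exact: ndg.
Qed.

End mppp_integral_theory.

Section simple_function_levels.
Import HBNNSimple.
Context {d} {T : measurableType d} {R : realType} (h : {nnsfun T >-> R}).

(** The value 0 is dropped: its level set contributes nothing to the sum over points and can have
    infinite intensity. *)
Definition pos_values : seq R := [seq r <- finmap.enum_fset (fset_set (range h)) | r != 0].

Lemma pos_values_gt0 r : r \in pos_values -> 0 < r.
Proof.
rewrite mem_filter => /andP[r0].
rewrite in_fset_set; last exact: fimfunP.
move=> /set_mem[y _ hy]; rewrite lt0r r0 -hy; exact: fun_ge0.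
Qed.

(** Stated for general [phi] because two cases are needed: the identity, for the sum over the
    points, and [1 - expR (- r)], for the exponent. *)
Lemma sum_pos_values (phi : R -> R) y : phi 0 = 0 ->
  phi (h y) = \sum_(i < size pos_values)
    phi (tnth (in_tuple pos_values) i) *
      \1_(h @^-1` [set tnth (in_tuple pos_values) i]) y.
Proof.
move=> phi0.
rewrite -(big_tnth _ _ _ xpredT (fun r => phi r * \1_(h @^-1` [set r]) y)).
have [hy0|hy0] := eqVneq (h y) 0.
  rewrite hy0 phi0 big_seq big1// => r /pos_values_gt0 r0.
  rewrite indicE memNset ?mulr0// => /= hr.
  by move: r0; rewrite -hr hy0 ltxx.
have hin : h y \in pos_values.
  rewrite mem_filter hy0 in_fset_set; last exact: fimfunP.
  by apply/mem_set; exists y.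
rewrite (bigD1_seq (h y))//=; last exact/filter_uniq/finmap.fset_uniq.
rewrite indicE mem_set//= mulr1 big1 ?addr0// => r rh.
by rewrite indicE memNset ?mulr0//= => /esym/eqP; rewrite (negbTE rh).
Qed.

End simple_function_levels.

Section coverage_laplace.
Import HBNNSimple.
Context {d} {T : measurableType d} {R : realType} (P : probability T R).
Variables (lam rc : R) (X : nat -> T -> R * R) (H : nat -> T -> R) (G : T -> R).
Hypothesis lam0 : 0 <= lam.
Hypothesis hP : marked_ppp_indep P lam rc X H G.

Definition point_sum (f : (R * R) * R -> R) (w : T) : \bar R :=
  (\sum_(n <oo) (f (X n w, H n w))%:E)%E.

Lemma point_sum_ge0 f w : (forall y, 0 <= f y) -> (0 <= point_sum f w)%E.
Proof. by move=> f0; apply: nneseries_ge0 => n _ _; rewrite lee_fin. Qed.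

Section simple.
Variable h : {nnsfun ((R * R) * R)%type >-> R}.
Hypothesis finh : forall r, 0 < r -> (mppp_intensity lam rc (h @^-1` [set r]) < +oo)%E.

Let k := size (pos_values h).
Let c (i : 'I_k) := tnth (in_tuple (pos_values h)) i.
Let A (i : 'I_k) := h @^-1` [set c i].

Let c0 i : 0 < c i. Proof. by apply: (@pos_values_gt0 _ _ _ h); exact: mem_tnth. Qed.
Let mA i : measurable (A i). Proof. exact: measurable_funPTI. Qed.
Let finA i : (mppp_intensity lam rc (A i) < +oo)%E. Proof. exact: finh. Qed.
Let disjA i j : i != j -> A i `&` A j = set0.
Proof.
move=> ij; apply/seteqP; split => // y [/= hi hj]; move/eqP: ij; apply.
have u : uniq (in_tuple (pos_values h)) by exact/filter_uniq/finmap.fset_uniq.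
by apply/(tuple_uniqP _ u); rewrite -/(c i) -/(c j) -hi hj.
Qed.

Let point_sum_simple w : point_sum h w = (\sum_(i < k) (c i)%:E * mcount X H (A i) w)%E.
Proof.
transitivity (\sum_(n <oo) \sum_(i < k) ((c i)%:E * (\1_(A i) (X n w, H n w))%:E))%E.
  apply: eq_eseriesr => n _.
  rewrite [h _](@sum_pos_values _ _ _ h idfun)// -sumEFin.
  by apply: eq_bigr => i _; rewrite EFinM.
rewrite nneseries_sum; last by move=> i n _; rewrite -EFinM lee_fin mulr_ge0// ltW.
by apply: eq_bigr => i _; rewrite nneseriesZl// => n _; rewrite lee_fin.
Qed.

Let mppp_integral_simple : mppp_integral lam rc (fun y => 1 - expR (- h y)) =
  (\sum_(i < k) fine (mppp_intensity lam rc (A i)) * (1 - expR (- c i)))%:E.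
Proof.
transitivity (mppp_integral lam rc (fun y => \sum_(i < k) (1 - expR (- c i)) * \1_(A i) y)).
  congr mppp_integral; apply/funext => y.
  apply: (@sum_pos_values _ _ _ h (fun r => 1 - expR (- r))).
  by rewrite oppr0 expR0 subrr.
have a0 i : 0 <= 1 - expR (- c i) by rewrite subr_ge0 -expR0 ler_expR oppr_le0 ltW.
have mi i : measurable_fun [set: (R * R) * R] (\1_(A i) : _ -> R).
  exact: measurable_indic.
rewrite (mppp_integral_sumZ lam rc a0 mi)//.
rewrite -sumEFin; apply: eq_bigr => i _; rewrite mulrC EFinM -mppp_intensityE//.
rewrite fineK// ge0_fin_numE//.
by rewrite mppp_intensityE//; apply: mppp_integral_ge0.
Qed.

Lemma prob_simple_point_sum t : 0 <= t ->
  P [set w | (point_sum h w + t%:E <= (G w)%:E)%E] =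
  (expR (- t) * expR (- fine (mppp_integral lam rc (fun y => 1 - expR (- h y)))))%:E.
Proof.
move=> t0; have := prob_weighted_counts hP mA finA disjA c0 t0.
under eq_set do rewrite -point_sum_simple.
move=> ->; rewrite mppp_integral_simple/= -sumrN; congr (_ * _)%:E.
by rewrite -expR_sum.
Qed.

End simple.
End coverage_laplace.

(** * From step functions to nonnegative measurable functions *)

Section coverage_limit.
Import HBNNSimple.
Context {d} {T : measurableType d} {R : realType} (P : probability T R).
Variables (lam rc : R) (X : nat -> T -> R * R) (H : nat -> T -> R) (G : T -> R).
Hypothesis lam0 : 0 <= lam.
Hypothesis hP : marked_ppp_indep P lam rc X H G.
Variable f : (R * R) * R -> R.
Hypotheses (mf : measurable_fun [set: (R * R) * R] f) (f0 : forall y, 0 <= f y).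
Let I (g : (R * R) * R -> R) := mppp_integral lam rc (fun y => 1 - expR (- g y)).
Hypothesis If_fin : (I f < +oo)%E.

Let laplace_ge0 (g : (R * R) * R -> R) y : 0 <= g y -> 0 <= 1 - expR (- g y).
Proof. by move=> g0; rewrite subr_ge0 -expR0 ler_expR oppr_le0. Qed.

Let laplace_meas (g : (R * R) * R -> R) : measurable_fun [set: (R * R) * R] g ->
  measurable_fun [set: (R * R) * R] (fun y => 1 - expR (- g y)).
Proof.
by move=> mg; apply: measurable_funB => //; do 2 apply: measurableT_comp => //.
Qed.

Let mEf : measurable_fun [set: (R * R) * R] (EFin \o f).
Proof. exact/measurable_EFinP. Qed.

Let f_ n : {nnsfun ((R * R) * R)%type >-> R} := nnsfun_approx measurableT mEf n.

Let f_le n y : f_ n y <= f y.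
Proof.
have h (z : (R * R) * R) : [set: (R * R) * R] z -> (0 <= (EFin \o f) z)%E.
  by move=> _; rewrite /= lee_fin.
have := @le_approx _ _ R _ (EFin \o f) n y h Logic.I.
by rewrite /f_ nnsfun_approxE lee_fin.
Qed.

Let f_nd y : {homo (fun n => f_ n y) : n m / (n <= m)%N >-> n <= m}.
Proof. by move=> n m nm; exact/lefP/nd_nnsfun_approx. Qed.

Let f_cvg y : f_ n y @[n --> \oo] --> f y.
Proof.
have h (z : (R * R) * R) : [set: (R * R) * R] z -> (0 <= (EFin \o f) z)%E.
  by move=> _; rewrite /= lee_fin.
by have /fine_cvg := @cvg_nnsfun_approx _ _ _ _ measurableT _ mEf h y Logic.I.
Qed.

Let If_ge0 (g : (R * R) * R -> R) : (forall y, 0 <= g y) -> (0 <= I g)%E.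
Proof. by move=> g0; apply: mppp_integral_ge0 => // y; exact: laplace_ge0. Qed.

(* [1 - expR (- r)] times the indicator of [f_ n = r] is below [1 - expR (- f)],
   whose intensity integral is finite. *)
Let f_level n r : 0 < r -> (mppp_intensity lam rc (f_ n @^-1` [set r]) < +oo)%E.
Proof.
move=> r0; have q0 : 0 < 1 - expR (- r) by rewrite subr_gt0 -expR0 ltr_expR oppr_lt0.
have mA : measurable (f_ n @^-1` [set r]) by exact: measurable_funPTI.
rewrite mppp_intensityE//.
pose a (i : 'I_1) := (1 - expR (- r))^-1.
have a0 i : 0 <= a i by rewrite invr_ge0 ltW.
apply: (@le_lt_trans _ _
    (mppp_integral lam rc (fun y => \sum_(i < 1) a i * (1 - expR (- f y))))).
  apply: le_mppp_integral => //.
    by apply: measurable_sum => i; apply: measurable_funM => //; exact: laplace_meas.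
  move=> y; rewrite big_ord1 indicE ler0n/= /a.
  have [/set_mem/= fr|_] := boolP (y \in _); last first.
    by rewrite mulr_ge0 ?invr_ge0 ?(ltW q0)// laplace_ge0.
  by rewrite mulrC ler_pdivlMr// mul1r lerD2l lerN2 ler_expR lerN2 -fr f_le.
rewrite (mppp_integral_sumZ lam rc a0); last 2 first.
- by move=> i; exact: laplace_meas.
- by move=> i y; exact: laplace_ge0.
by rewrite big_ord1 lte_mul_pinfty// ?lee_fin.
Qed.

Let mX n : measurable_fun [set: T] (X n). Proof. by case: hP. Qed.
Let mH n : measurable_fun [set: T] (H n). Proof. by case: hP. Qed.
Let mG : measurable_fun [set: T] G. Proof. by case: hP. Qed.

Let event_le (g : (R * R) * R -> R) t :=
  [set w | (point_sum X H g w + t%:E <= (G w)%:E)%E].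

Let measurable_event_le (g : (R * R) * R -> R) (t : R) :
  measurable_fun [set: (R * R) * R] g -> (forall y, 0 <= g y) ->
  measurable (event_le g t).
Proof.
move=> mg g0; rewrite -[X in measurable X]setTI; apply: measurable_lee => //.
  by apply: emeasurable_funD => //; exact: measurable_point_sum.
exact/measurable_EFinP.
Qed.

(** For the hard inclusion, each finite partial sum for [f] is the limit of those for [f_ n], all
    below [G w - t]; a non-strict bound survives this limit and then the one over partial sums. *)
Let event_le_bigcap t : event_le f t = \bigcap_n event_le (f_ n) t.
Proof.
apply/seteqP; split => w; rewrite /event_le/=.
  move=> h n _ /=; apply: le_trans h; rewrite leeD2r//.
  by apply: lee_nneseries => [i _|i _]; rewrite lee_fin.
move=> h; rewrite -leeBrDr//; apply: lime_le.
  by apply: is_cvg_nneseries => i _ _; rewrite lee_fin.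
apply: nearW => m; rewrite sumEFin.
have c : (\sum_(0 <= i < m) f_ n (X i w, H i w))%:E @[n --> \oo] -->
    (\sum_(0 <= i < m) f (X i w, H i w))%:E.
  apply: cvg_EFin; first exact: nearW.
  by apply: cvg_big => [|i _]; [exact: add_continuous|exact: f_cvg].
rewrite -(cvg_lim _ c)//; apply: lime_le; first by apply/cvg_ex; eexists; exact: c.
apply: nearW => n; rewrite leeBrDr//; apply: le_trans (h n Logic.I).
rewrite leeD2r// -sumEFin; apply: nneseries_lim_ge => i _ _.
by rewrite lee_fin.
Qed.

Lemma prob_point_sum_le t : 0 <= t ->
  P (event_le f t) = (expR (- t) * expR (- fine (I f)))%:E.
Proof.
move=> t0.
have cP : (P \o (fun n => event_le (f_ n) t)) n @[n --> \oo] --> P (event_le f t).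
  rewrite event_le_bigcap; apply: nonincreasing_cvg_mu.
  - by rewrite (le_lt_trans (probability_le1 _ _)) ?ltry//; exact: measurable_event_le.
  - by move=> n; exact: measurable_event_le.
  - by apply: bigcapT_measurable => n; exact: measurable_event_le.
  - move=> n m nm; apply/subsetPset => w; apply: le_trans; rewrite leeD2r//.
    by apply: lee_nneseries => [i _|i _]; rewrite lee_fin// f_nd.
have cI : I (f_ n) @[n --> \oo] --> I f.
  apply: cvg_mppp_integral => //.
  - by move=> n; exact: laplace_meas.
  - by move=> n y; exact: laplace_ge0.
  - move=> y n m nm; rewrite lerD2l lerN2 ler_expR lerN2; exact: f_nd.
  - move=> y; apply: cvgB; first exact: cvg_cst.
    apply: continuous_cvg; first exact: continuous_expR.
    by apply: cvgN; exact: f_cvg.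
have eP : P \o (fun n => event_le (f_ n) t) =
    fun n => (expR (- t) * expR (- fine (I (f_ n))))%:E.
  by apply/funext => n; rewrite /= (prob_simple_point_sum lam0 hP (f_level n) t0).
rewrite eP in cP; apply: (cvg_unique _ cP) => //; apply: cvg_EFin; first exact: nearW.
apply: cvgMl_tmp; apply: continuous_cvg; first exact: continuous_expR.
(* Finiteness of [I f] is what allows [fine] to pass to the limit. *)
apply: cvgN; apply: fine_cvg; rewrite fineK// ge0_fin_numE//.
exact: If_ge0.
Qed.

Let event_lt t := [set w | (point_sum X H f w + t%:E < (G w)%:E)%E].

(** A strict inequality between reals leaves a gap of some [1 / (n + 1)]; where the point sum is
    infinite, neither side holds. *)
Let event_lt_bigcup t : event_lt t = \bigcup_n event_le f (t + n.+1%:R^-1).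
Proof.
have S0 w := @point_sum_ge0 _ _ _ X H f w f0.
apply/seteqP; split => w.
  rewrite /event_lt/=; have := S0 w; case E: (point_sum X H f w) => [s| |//] _.
    rewrite -EFinD lte_fin => sG; have [n hn] := ltr_add_invr sG.
    by exists n => //; rewrite /event_le/= E -EFinD lee_fin addrA ltW.
  by rewrite addye.
move=> [n _]; rewrite /event_lt /event_le/=.
have := S0 w; case E: (point_sum X H f w) => [s| |//] _.
  rewrite -!EFinD lee_fin lte_fin; apply: lt_le_trans.
  by rewrite addrA ltrDl invr_gt0.
by rewrite addye// leye_eq.
Qed.

Lemma prob_point_sum_lt t : 0 <= t ->
  P (event_lt t) = (expR (- t) * expR (- fine (I f)))%:E.
Proof.
move=> t0.
have cP : (P \o (fun n => event_le f (t + n.+1%:R^-1))) n @[n --> \oo] --> P (event_lt t).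
  rewrite event_lt_bigcup; apply: nondecreasing_cvg_mu.
  - by move=> n; exact: measurable_event_le.
  - by apply: bigcupT_measurable => n; exact: measurable_event_le.
  - move=> n m nm; apply/subsetPset => w; apply: le_trans; rewrite leeD2l//.
    by rewrite lee_fin lerD2l lef_pV2 ?posrE// ler_nat.
have eP : P \o (fun n => event_le f (t + n.+1%:R^-1)) =
    fun n => (expR (- (t + n.+1%:R^-1)) * expR (- fine (I f)))%:E.
  by apply/funext => n; rewrite /= prob_point_sum_le// addr_ge0.
rewrite eP in cP; apply: (cvg_unique _ cP) => //; apply: cvg_EFin; first exact: nearW.
apply: cvgMr_tmp; apply: continuous_cvg; first exact: continuous_expR.
apply: cvgN; rewrite -[X in _ --> X]addr0; apply: cvgD; first exact: cvg_cst.
exact: cvg_harmonic.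
Qed.

End coverage_limit.

(** * The coverage event *)

Section measurable_limn.
Context {d} {T : measurableType d} {R : realType}.

(** The sequence is squeezed between its tail infima and its tail suprema. *)
Lemma limn_einf_esup_cvg (u : (\bar R)^nat) : limn_einf u = limn_esup u -> cvgn u.
Proof.
rewrite limn_einf_lim limn_esup_lim => uE.
have c1 := is_cvg_einfs (u := u); have c2 := is_cvg_esups (u := u).
apply/cvg_ex; exists (limn (esups u)).
apply: (@squeeze_cvge _ _ _ _ (einfs u) _ (esups u)) => //.
- apply: nearW => n; apply/andP; split.
    by apply: ereal_inf_lbound; exists n => //=.
  by apply: ereal_sup_ubound; exists n => //=.
- by rewrite -uE.
Qed.

(* [limn] of a divergent sequence is the default point, hence the case split. *)
Lemma measurable_fun_limn (u : nat -> T -> \bar R) :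
  (forall n, measurable_fun [set: T] (u n)) ->
  measurable_fun [set: T] (fun w => limn (u ^~ w)).
Proof.
move=> mu.
have mi : measurable_fun [set: T] (fun w => limn_einf (u ^~ w)).
  rewrite (_ : (fun w => _) = fun w => (- limn_esup ((fun n w => - u n w) ^~ w))%E).
    apply: measurableT_comp => //; apply: measurable_fun_limn_esup => n.
    exact: measurableT_comp.
  apply/funext => w; rewrite -limn_einfN; congr limn_einf.
  by apply/funext => n /=; rewrite oppeK.
have ms := measurable_fun_limn_esup mu.
rewrite (_ : (fun w => _) = fun w =>
  if limn_einf (u ^~ w) == limn_esup (u ^~ w) then limn_esup (u ^~ w) else point).
  by apply: measurable_fun_ifT => //; exact: measurable_fun_eqe.
apply/funext => w; case: eqP => [/limn_einf_esup_cvg c|ne].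
  exact/esym/(cvg_limn_einf_sup c).2.
by apply: dvgP => c; apply: ne; rewrite !(cvg_limn_einf_sup c).
Qed.

Lemma measurable_invr : measurable_fun [set: R] (@GRing.inv R).
Proof.
rewrite (_ : GRing.inv = fun x : R =>
    if 0 <= x then x `^ (- 1) else - ((- x) `^ (- 1))); last first.
  apply/funext => x; case: leP => [x0|x0]; first by rewrite powR_inv1.
  by rewrite powR_inv1 ?invrN ?opprK// oppr_ge0 ltW.
apply: measurable_fun_ifT; first exact: measurable_fun_ler.
- exact: measurable_powR.
- apply: measurableT_comp => //.
  by apply: (measurableT_comp (measurable_powR (- 1))).
Qed.

Lemma prob_setI1 (P : probability T R) (A Z : set T) : measurable A -> measurable Z ->
  P Z = 1%E -> P A = P (A `&` Z).
Proof.
move=> mA mZ PZ; rewrite (measureDI P mA mZ) -[RHS]add0e; congr (_ + _)%E.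
have PC : P (~` Z) = 0%E by rewrite probability_setC// PZ subee.
apply/eqP; rewrite eq_le measure_ge0 andbT -PC; apply: le_measure.
- by apply/mem_set; exact: measurableD.
- by apply/mem_set; exact: measurableC.
- by move=> w [].
Qed.

End measurable_limn.

(** * The almost sure event *)

Section good_event.
Context {d} {T : measurableType d} {R : realType} (P : probability T R).
Variables (lam rc : R) (X : nat -> T -> R * R) (H : nat -> T -> R) (G : T -> R).
Hypothesis hP : marked_ppp_indep P lam rc X H G.

Definition marked_exterior : set ((R * R) * R) := [set y | rc < norm2 y.1 /\ 0 <= y.2].

Lemma measurable_marked_exterior : measurable marked_exterior.
Proof.
rewrite (_ : marked_exterior =
  ([set: (R * R) * R] `&` (fun y => norm2 y.1) @^-1` `]rc, +oo[%classic) `&`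
  ([set: (R * R) * R] `&` snd @^-1` `[0, +oo[%classic)).
  apply: measurableI.
    have mn : measurable_fun [set: (R * R) * R] (fun y => norm2 y.1).
      exact: (measurableT_comp measurable_norm2).
    by apply: mn => //; exact: measurable_itv.
  have ms : measurable_fun [set: (R * R) * R] snd by exact: measurable_snd.
  by apply: ms => //; exact: measurable_itv.
by apply/seteqP; split => y; rewrite !setTI /marked_exterior/= !in_itv/= !andbT.
Qed.

Lemma mppp_intensity_exteriorC : mppp_intensity lam rc (~` marked_exterior) = 0%E.
Proof.
rewrite mppp_intensityE; last by apply: measurableC; exact: measurable_marked_exterior.
rewrite /mppp_integral integral0_eq ?mule0// => y _.
rewrite /mppp_density !indicE.
case: (boolP (y \in ~` _)) => [|_]; last by rewrite mul0r.
move=> /set_mem/= yC; rewrite mul1r.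
case: (boolP (y.1 \in _)) => [/set_mem/= y1|_]; last by rewrite !mul0r.
case: (boolP (y.2 \in _)) => [/set_mem/= y2|_]; last by rewrite mulr0 mul0r.
by exfalso; apply: yC; split.
Qed.

Definition good_event : set T := [set w | 0 <= G w] `&`
  [set w | mcount X H (~` marked_exterior) w = 0%E].

Lemma good_eventP w : good_event w ->
  0 <= G w /\ forall n, rc < norm2 (X n w) /\ 0 <= H n w.
Proof.
move=> [/= G0 N0]; split => // n; apply: contrapT => nE.
have n0 i : (0 <= i)%N -> true -> (0 <= (\1_(~` marked_exterior) (X i w, H i w) : R)%:E)%E.
  by move=> _ _; rewrite lee_fin.
have := nneseries_lim_ge n.+1 n0; rewrite -/(mcount _ _ _ _) N0 => /le_lt_trans.
move=> /(_ 1%E lte01); rewrite sumEFin lte_fin big_nat_recr//= ltNge.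
rewrite [X in _ + X]indicE mem_set//= lerDr sumr_ge0// => i _; exact: ler0n.
Qed.

Lemma measurable_good_event : measurable good_event.
Proof.
have [mX mH mG _ _] := hP.
apply: measurableI.
  rewrite (_ : [set w | _] = [set: T] `&` G @^-1` `[0, +oo[%classic).
    by apply: mG => //; exact: measurable_itv.
  by apply/seteqP; split => w; rewrite setTI/= in_itv/= andbT.
rewrite -[X in measurable X]setTI; apply: measurable_eqe => //.
by apply: measurable_mcount => //; apply: measurableC; exact: measurable_marked_exterior.
Qed.

Lemma prob_good_event : P good_event = 1%E.
Proof.
have [_ _ _ _ hI] := hP.
have := hI 1%N (fun=> ~` marked_exterior) (fun=> 0%N) `[0, +oo[%classic.
rewrite big_ord1 mppp_intensity_exteriorC (prob_fading_ge hP)//.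
rewrite oppr0 expR0 /poisson_pk oppr0 expR0 mul1r expr0 fact0 divr1 mule1 => <-//.
- congr (P _); congr (_ `&` _).
    by apply/seteqP; split => w; rewrite /preimage/= in_itv/= andbT.
  by apply/seteqP; split => w /= => [hN i _//|hN]; exact: (hN ord0 Logic.I).
- by move=> _; apply: measurableC; exact: measurable_marked_exterior.
- by move=> i j; rewrite !ord1 eqxx.
Qed.

End good_event.

(** Both sides say [th * (i + s2) < (ac - th * at_) * S * g]; the sign of [ac - th * at_] preserves
    the direction on division. *)
Lemma sinr_gt_iff {R : realType} (ac at_ th S s2 g i : R) :
  0 < at_ -> 0 < S -> 0 < s2 -> 0 < ac - th * at_ -> 0 <= g -> 0 <= i ->
  (th < ac * S * g / (at_ * S * g + i + s2)) =
  (th / (ac - th * at_) / S * i + th / (ac - th * at_) / S * s2 < g).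
Proof.
move=> at0 S0 s20 q0 g0 i0.
have den : 0 < at_ * S * g + i + s2 by rewrite ltr_wpDl// addr_ge0// !mulr_ge0// ltW.
have qS : 0 < (ac - th * at_) * S by rewrite mulr_gt0.
have -> : th / (ac - th * at_) / S * i + th / (ac - th * at_) / S * s2 =
    th * (i + s2) / ((ac - th * at_) * S) by field; rewrite !gt_eqF.
rewrite ltr_pdivlMr// ltr_pdivrMr// -subr_gt0 -[in RHS]subr_gt0.
by congr (0 < _); ring.
Qed.

Theorem theorem3 (R : realType) (d : measure_display) (T : measurableType d)
  (P : probability T R)
  (lam rc alpha Pt Cc s2 ac at_ th : R)
  (X : nat -> T -> R * R) (H : nat -> T -> R) (G : T -> R) :
  0 < lam -> 0 < rc -> 2 < alpha -> 0 < Pt -> 0 < Cc -> 0 < s2 ->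
  0 < ac -> 0 < at_ -> ac + at_ = 1 -> 0 < th -> 0 < ac - th * at_ ->
  marked_ppp_indep P lam rc X H G ->
  let S := Pt * Cc * powR rc (- alpha) in
  let Ic := interference Pt Cc alpha X H in
  let Xi3 := th * s2 / ((ac - th * at_) * Pt * Cc) in
  let Xi4 := pi * lam *
    (hyp2F1 (- (2 / alpha)) 1 (1 - 2 / alpha) (- (th / (ac - th * at_))) - 1) in
  P [set w | (Ic w < +oo)%E /\
             th < ac * S * G w / (at_ * S * G w + fine (Ic w) + s2)]
  = (expR (- (Xi3 * powR rc alpha)) * expR (- (Xi4 * rc ^+ 2)))%:E.
Proof.
move=> lam0 rc0 alpha2 Pt0 Cc0 s20 ac0 at0 _ th0 q0 hP S Ic Xi3 Xi4.
set E := [set w | _].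
have [mX mH mG _ _] := hP.
have rca : 0 < rc `^ alpha by exact: powR_gt0.
have S0 : 0 < S by rewrite !mulr_gt0// powR_gt0.
pose z0 := th / (ac - th * at_).
have z00 : 0 < z0 by rewrite divr_gt0.
(* [K] is the coefficient of the interference once the coverage inequality is solved for [G]; [KE]
   identifies [K] times the gain with the constant of [f]. *)
pose K := z0 / S; have K0 : 0 < K by rewrite divr_gt0.
have KE : K * (Pt * Cc) = z0 * rc `^ alpha.
  by rewrite /K /S powRN; field; rewrite !gt_eqF.
pose f := path_gain alpha (z0 * rc `^ alpha).
have c0 : 0 <= z0 * rc `^ alpha by rewrite mulr_ge0// ltW.
have mf : measurable_fun [set: (R * R) * R] f by exact: measurable_path_gain.
have f0 y : 0 <= f y by exact: path_gain_ge0.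
have I_f := mppp_integral_laplace lam rc0 alpha2 z00.
have IcE w : good_event rc X H G w -> point_sum X H f w = (K%:E * Ic w)%E /\ (0 <= Ic w)%E.
  move=> /good_eventP[_ wXH].
  have Ic0 n : (0 <= (Pt * Cc * norm2 (X n w) `^ (- alpha) * H n w)%:E)%E.
    by rewrite lee_fin !mulr_ge0 ?powR_ge0 ?(ltW Pt0) ?(ltW Cc0)//; have [] := wXH n.
  split; last by apply: nneseries_ge0 => n _ _.
  rewrite /Ic /interference -nneseriesZl//; apply: eq_eseriesr => n _.
  rewrite -EFinM /f /path_gain/= -KE; have [_ Hn] := wXH n.
  by rewrite (max_idPl Hn) !mulrA.
have mE : measurable E.
  (* Off the good event marks may be negative and the series may diverge, so measurability is
     obtained for [limn] without assuming convergence. *)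
  have mIc : measurable_fun [set: T] Ic.
    apply: (@measurable_fun_limn _ _ _ (fun n w =>
      \sum_(0 <= i < n) (Pt * Cc * norm2 (X i w) `^ (- alpha) * H i w)%:E)%E) => n.
    apply: emeasurable_sum => i; apply/measurable_EFinP; apply: measurable_funM => //.
    apply: measurable_funM => //.
    apply: (measurableT_comp (measurable_powR (- alpha))).
    exact: (measurableT_comp measurable_norm2).
  have mr : measurable_fun [set: T]
      (fun w => ac * S * G w / (at_ * S * G w + fine (Ic w) + s2)).
    apply: measurable_funM; first exact: measurable_funM.
    apply: (measurableT_comp measurable_invr).
    apply: measurable_funD => //; apply: measurable_funD; first exact: measurable_funM.
    exact: measurableT_comp.
  rewrite (_ : E = ([set: T] `&` [set w | (Ic w < +oo)%E]) `&`
      ([set: T] `&` (fun w => ac * S * G w / (at_ * S * G w + fine (Ic w) + s2))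
        @^-1` `]th, +oo[%classic)).
    apply: measurableI; last by apply: mr => //; exact: measurable_itv.
    exact: measurable_lte.
  by rewrite !setTI; apply/seteqP; split => w; rewrite /E/= in_itv/= andbT.
pose E' := [set w | (point_sum X H f w + (K * s2)%:E < (G w)%:E)%E].
have mE' : measurable E'.
  rewrite -[X in measurable X]setTI; apply: measurable_lte => //.
    by apply: emeasurable_funD => //; exact: measurable_point_sum.
  exact/measurable_EFinP.
have mZ := measurable_good_event hP.
have PZ := prob_good_event hP.
rewrite (prob_setI1 mE mZ PZ).
have -> : E `&` good_event rc X H G = E' `&` good_event rc X H G.
  suff EE' w : good_event rc X H G w -> E w <-> E' w.
    by apply/seteqP; split => w [? Zw]; split => //; apply/EE'.
  move=> Zw; have [G0 _] := good_eventP Zw; have [SI I0] := IcE _ Zw.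
  rewrite /E /E'/= SI; case: (Ic w) I0 => [i i0| |//].
    rewrite ltry -EFinM -EFinD lte_fin /=.
    by rewrite (sinr_gt_iff at0 S0 s20 q0 G0)//; split => [[]|].
  (* If [Ic w] is infinite both events fail; on the side of [E] it is the finiteness clause that
     fails, as [fine] would send [+oo] to 0. *)
  by rewrite gt0_muley ?lte_fin// addye//; split => // -[].
rewrite -(prob_setI1 mE' mZ PZ).
rewrite (prob_point_sum_lt (ltW lam0) hP mf f0); last 2 first.
- by rewrite I_f ltry.
- by rewrite mulr_ge0// ltW.
rewrite I_f/=; congr (_ * _)%:E; congr expR; congr (- _).
  by rewrite /K /z0 /S /Xi3 powRN; field; rewrite !gt_eqF.
by rewrite /Xi4; ring.
Qed.
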